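(* There exists a deterministic algorithm that, given an unweighted undirected graph $G$ with $n$ vertices undergoing edge insertions and deletions, maintains a $3$-spanner of $G$ containing $O(n^{1.5})$ edges using $O(\min\{\Delta,\sqrt{n}\}\log n)$ worst-case update time, where $\Delta$ is the maximum degree of $G$.
   Context: For an unweighted undirected graph $G=(V,E)$, an $\alpha$-spanner is a subgraph $H=(V,E_H)$ with $E_H\subseteq E$ such that $\operatorname{dist}_G(u,v)\le \operatorname{dist}_H(u,v)\le \alpha\cdot \operatorname{dist}_G(u,v)$ for all $u,v\in V$. In the fully dynamic setting the graph undergoes a sequence of edge insertions and deletions and the algorithm must maintain a spanner of the current graph after each update. Worst-case update time $O(f)$ means every single update is processed in time $O(f)$. *)

(* Defs.v *)
From mathcomp Require Import all_boot all_order all_algebra.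
From mathcomp Require Import classical_sets reals ereal exp.

Set Implicit Arguments.
Unset Strict Implicit.
Unset Printing Implicit Defensive.

Import Order.TTheory GRing.Theory Num.Theory.

Notation edge_set n := {set {set 'I_n}}.

Definition simple_graph n (E : edge_set n) : bool := [forall e in E, #|e| == 2].

Definition adj n (E : edge_set n) : rel 'I_n :=
  fun u v => finset.setU (finset.set1 u) (finset.set1 v) \in E.

Definition degree n (E : edge_set n) (u : 'I_n) : nat := #|adj E u|.

Definition max_degree n (E : edge_set n) : nat := \max_(u < n) degree E u.

(* Length of a shortest path; [+oo] (the infimum of the empty set) when
   there is no path. *)
Definition dist (R : realType) n (E : edge_set n) (u v : 'I_n) : \bar R :=
  ereal_inf [set d : \bar R | exists p : seq 'I_n,
    [/\ path (adj E) u p, last u p = v & d = ((size p)%:R)%:E]]%classic.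

Definition spanner (R : realType) (alpha : R) n (E H : edge_set n) : Prop :=
  H \subset E /\
  forall u v : 'I_n,
    (dist R E u v <= dist R H u v)%E /\
    (dist R H u v <= alpha%:E * dist R E u v)%E.

Inductive update n := Insert of 'I_n & 'I_n | Delete of 'I_n & 'I_n.

Definition update_edge n (up : update n) : {set 'I_n} :=
  match up with Insert u v | Delete u v =>
    finset.setU (finset.set1 u) (finset.set1 v) end.

Definition valid_update n (E : edge_set n) (up : update n) : bool :=
  match up with
  | Insert u v => (u != v) && ~~ adj E u v
  | Delete u v => adj E u v
  end.

Definition apply_update n (E : edge_set n) (up : update n) : edge_set n :=
  match up with
  | Insert _ _ => finset.setU E (finset.set1 (update_edge up))
  | Delete _ _ => finset.setD E (finset.set1 (update_edge up))
  end.

(** A word RAM, programmed in a structured language.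
    Words are natural numbers below [2 ^ w]; all arithmetic is modulo [2 ^ w].
    Registers are named by naturals, but a fixed program only mentions finitely
    many of them.  Indirect addressing is available through [Read] and [Write].
    Every constant, register read, memory read, arithmetic operation,
    skip, assignment, write, test and output costs one unit of time. *)

Inductive binop := OpAdd | OpSub | OpMul | OpDiv | OpMod | OpEq | OpLt.

Inductive expr :=
| Const of nat
| Reg of nat
| Read of expr
| Bin of binop & expr & expr.

(* [OutInsert] and [OutDelete] insert an edge into, or delete an edge from,
   the output graph.  Programs cannot read the output graph. *)
Inductive cmd :=
| Skip
| Assign of nat & expr
| Write of expr & expr
| OutInsert of expr & expr
| OutDelete of expr & expr
| Seq of cmd & cmd
| If of expr & cmd & cmd
| While of expr & cmd.

Record state n := State {
  reg : nat -> nat;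
  mem : nat -> nat;
  out : edge_set n }.

Definition upd (f : nat -> nat) (a x : nat) : nat -> nat :=
  fun b => if b == a then x else f b.

Definition set_reg n (s : state n) (a x : nat) : state n :=
  State (upd (reg s) a x) (mem s) (out s).
Definition set_mem n (s : state n) (a x : nat) : state n :=
  State (reg s) (upd (mem s) a x) (out s).
Definition set_out n (s : state n) (H : edge_set n) : state n :=
  State (reg s) (mem s) H.

(* The edge denoted by a pair of words.  If the words are not two distinct
   vertices, the result is not a two-element set, hence not an edge of any
   simple graph. *)
Definition word_edge n (a b : nat) : {set 'I_n} :=
  finset (fun x : 'I_n => ((x : nat) == a) || ((x : nat) == b)).

(* Subtraction wraps around; division by 0 gives 0 and [a] modulo 0 is [a]. *)
Definition binop_sem (w : nat) (o : binop) (a b : nat) : nat :=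
  (match o with
   | OpAdd => a + b
   | OpSub => a + 2 ^ w - b
   | OpMul => a * b
   | OpDiv => a %/ b
   | OpMod => a %% b
   | OpEq => a == b
   | OpLt => a < b
   end %% 2 ^ w)%N.

Fixpoint eval n (w : nat) (s : state n) (e : expr) : nat :=
  match e with
  | Const c => (c %% 2 ^ w)%N
  | Reg x => reg s x
  | Read e1 => mem s (eval w s e1)
  | Bin o e1 e2 => binop_sem w o (eval w s e1) (eval w s e2)
  end.

Fixpoint ecost (e : expr) : nat :=
  match e with
  | Const _ | Reg _ => 1
  | Read e1 => (ecost e1).+1
  | Bin _ e1 e2 => (ecost e1 + ecost e2).+1
  end.

(* [exec w c s t s']: with word size [w], the command [c] started in state [s]
   halts in state [s'] after [t] units of time. *)
Inductive exec n (w : nat) : cmd -> state n -> nat -> state n -> Prop :=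
| ExecSkip s : exec w Skip s 1 s
| ExecAssign x e s :
    exec w (Assign x e) s (ecost e).+1 (set_reg s x (eval w s e))
| ExecWrite e1 e2 s :
    exec w (Write e1 e2) s (ecost e1 + ecost e2).+1
      (set_mem s (eval w s e1) (eval w s e2))
| ExecOutInsert e1 e2 s :
    exec w (OutInsert e1 e2) s (ecost e1 + ecost e2).+1
      (set_out s (finset.setU (out s)
         (finset.set1 (word_edge n (eval w s e1) (eval w s e2)))))
| ExecOutDelete e1 e2 s :
    exec w (OutDelete e1 e2) s (ecost e1 + ecost e2).+1
      (set_out s (finset.setD (out s)
         (finset.set1 (word_edge n (eval w s e1) (eval w s e2)))))
| ExecSeq c1 c2 s1 t1 s2 t2 s3 :
    exec w c1 s1 t1 s2 -> exec w c2 s2 t2 s3 ->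
    exec w (Seq c1 c2) s1 (t1 + t2)%N s3
| ExecIf e c1 c2 s t s' :
    exec w (if eval w s e != 0 then c1 else c2) s t s' ->
    exec w (If e c1 c2) s (ecost e + t).+1 s'
| ExecWhileFalse e c s :
    eval w s e = 0 -> exec w (While e c) s (ecost e).+1 s
| ExecWhileTrue e c s1 t1 s2 t2 s3 :
    eval w s1 e <> 0 -> exec w c s1 t1 s2 -> exec w (While e c) s2 t2 s3 ->
    exec w (While e c) s1 (ecost e + t1 + t2).+1 s3.

Lemma exec_deterministic n w c (s : state n) t1 s1 t2 s2 :
  exec w c s t1 s1 -> exec w c s t2 s2 -> t1 = t2 /\ s1 = s2.
Proof.
move=> H; elim: H t2 s2 => {c s t1 s1}
  [s|x e s|e1 e2 s|e1 e2 s|e1 e2 s|c1 c2 s1 t1 s2 t2 s3 _ IH1 _ IH2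
  |e c1 c2 s t s' _ IH|e c s e0|e c s1 t1 s2 t2 s3 ne _ IH1 _ IH2] u r H;
  inversion H; subst => //;
  repeat match goal with
  | IH : (forall t s, exec _ _ ?s0 t s -> _ = t /\ _ = s),
    E : exec _ _ ?s0 _ _ |- _ => case: (IH _ _ E) => ? ?; subst; clear E
  end; by [].
Qed.

(* A single pair of programs, hence uniform in the number of vertices. *)
Record dyn_algorithm := DynAlgorithm {
  init_prog : cmd;
  update_prog : cmd }.

(* Words of [Theta(log n)] bits; [n < 2 ^ word_bits k n] for every [k]. *)
Definition word_bits (k n : nat) : nat := (k.+1 * (trunc_log 2 n).+1)%N.

(* Register 0 holds [n], the cells of address below [n ^ 2] hold the adjacency
   matrix of the graph in row-major order; everything else is 0 and the output
   graph is empty. *)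
Definition input_state n (E : edge_set n) : state n :=
  State (fun x => if x == 0 then n else 0)
        (fun a => (a < n * n) && (word_edge n (a %/ n) (a %% n) \in E) : nat)%N
        finset.set0.

(* Registers 1, 2, 3 receive the kind of the update (1 for an insertion, 0 for
   a deletion) and the two endpoints; the rest of the state is kept. *)
Definition receive n (up : update n) (s : state n) : state n :=
  match up with
  | Insert u v => set_reg (set_reg (set_reg s 1 1) 2 u) 3 v
  | Delete u v => set_reg (set_reg (set_reg s 1 0) 2 u) 3 v
  end.

(* [reachable A w E0 E s]: after initialization on [E0] and some sequence of
   valid updates, the current graph is [E] and the machine is in state [s]. *)
Inductive reachable (A : dyn_algorithm) n (w : nat) (E0 : edge_set n) :
    edge_set n -> state n -> Prop :=
| ReachInit t s :
    exec w (init_prog A) (input_state E0) t s -> reachable A w E0 E0 s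
| ReachUpdate E s up t s' :
    reachable A w E0 E s -> valid_update E up ->
    exec w (update_prog A) (receive up s) t s' ->
    reachable A w E0 (apply_update E up) s'.

(* Maximum degree of the graph undergoing the update, with the updated edge
   present: an insertion into, or a deletion resulting in, the empty graph
   has [Delta = 1]. *)
Definition update_max_degree n (E : edge_set n) (up : update n) : nat :=
  maxn (max_degree E) (max_degree (apply_update E up)).

(* Main.v *)
From mathcomp Require Import all_boot all_order all_algebra.
From mathcomp Require Import reals ereal exp.
From mathcomp Require Import zify lra.
Require Import Defs.

(**
  Let [q] be the ceiling of the square root of [n], and cut the vertices into
  at most [q] buckets [x %/ q] of at most [q] vertices.  Every vertex [v] with
  a neighbour in a bucket selects one of them, its partner there.  For two
  vertices [p] and [x] of the same bucket, let [W p x] be the set of the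
  neighbours [v] of [x] whose partner in that bucket is [p].  The spanner
  consists of the edges from a vertex to its partners and, for every nonempty
  [W p x], of one edge [z x] with [z] in [W p x], at most [2 n q] edges.  An
  edge [u v] is replaced by [u p z v], where [p] is the partner of [u] in the
  bucket of [v] and [z] the element selected in [W p v].

  The neighbours of a vertex in a bucket and the sets [W p x] are kept in
  arrays without repetitions, whose first elements are the selected ones.
  An edge update is two updates of an arc [v -> u]: remove [v] from the sets
  [W p x] of all neighbours [x] in the bucket of [u], update the array of
  these neighbours, and insert [v] into the sets for the new partner.  Both
  passes visit at most [minn (degree v) q] vertices in constant time each.
*)

Set Implicit Arguments.
Unset Strict Implicit.
Unset Printing Implicit Defensive.

Import Order.TTheory GRing.Theory Num.Theory.
Local Open Scope nat_scope.

(** * Executions of programs and bounds on their time *)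

Section Execution.
Context (n w : nat).
Implicit Types (s : state n) (c : cmd) (e : expr).

Fixpoint loop_free c : bool :=
  match c with
  | Seq c1 c2 | If _ c1 c2 => loop_free c1 && loop_free c2
  | While _ _ => false
  | _ => true
  end.

(* Junk on loops. *)
Fixpoint sem c s : state n :=
  match c with
  | Skip | While _ _ => s
  | Assign x e => set_reg s x (eval w s e)
  | Write e1 e2 => set_mem s (eval w s e1) (eval w s e2)
  | OutInsert e1 e2 =>
      set_out s (out s :|: [set word_edge n (eval w s e1) (eval w s e2)])
  | OutDelete e1 e2 =>
      set_out s (out s :\: [set word_edge n (eval w s e1) (eval w s e2)])
  | Seq c1 c2 => sem c2 (sem c1 s)
  | If e c1 c2 => if eval w s e != 0 then sem c1 s else sem c2 s
  end.

Fixpoint ccost c : nat :=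
  match c with
  | Skip => 1
  | Assign _ e => (ecost e).+1
  | Write e1 e2 | OutInsert e1 e2 | OutDelete e1 e2 => (ecost e1 + ecost e2).+1
  | Seq c1 c2 => ccost c1 + ccost c2
  | If e c1 c2 => (ecost e + maxn (ccost c1) (ccost c2)).+1
  | While _ _ => 0
  end.

(** [T] is only an upper bound, since the branches of a test may differ in time. One halting
    execution is enough: [exec] is deterministic, so [Q] passes to every execution. *)
Definition run c s (T : nat) (Q : state n -> Prop) : Prop :=
  exists t s', [/\ exec w c s t s', t <= T & Q s'].

Lemma run_sem c s : loop_free c -> run c s (ccost c) (eq (sem c s)).
Proof.
elim: c s => [|x e|e1 e2|e1 e2|e1 e2|c1 IH1 c2 IH2|e c1 IH1 c2 IH2|e c _] s //=;
  try by move=> _; do 2!eexists; split; first by constructor.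
- case/andP=> /IH1 h1 /IH2 h2.
  have [t1 [s1 [x1 l1 ->]]] := h1 s; have [t2 [s2 [x2 l2 ->]]] := h2 s1.
  by exists (t1 + t2), s2; split=> //; [exact: ExecSeq x2 | exact: leq_add].
- case/andP=> /IH1 h1 /IH2 h2.
  have [t [s' [h l ->]]] :
      run (if eval w s e != 0 then c1 else c2) s (maxn (ccost c1) (ccost c2))
        (eq (if eval w s e != 0 then sem c1 s else sem c2 s)).
    case: ifP => _; [have [t [s' [x l q]]] := h1 s | have [t [s' [x l q]]] := h2 s];
      by exists t, s'; split=> //; rewrite leq_max l ?orbT.
  by exists (ecost e + t).+1, s'; split; [constructor | rewrite ltnS leq_add2l |].
Qed.

Lemma run_impl c s T T' (Q Q' : state n -> Prop) :
  T <= T' -> (forall s', Q s' -> Q' s') -> run c s T Q -> run c s T' Q'.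
Proof.
by move=> lT QQ' [t [s' [x l q]]]; exists t, s'; split; [|exact: leq_trans lT|exact: QQ'].
Qed.

Lemma run_seq c1 c2 s T1 T2 (Q1 Q : state n -> Prop) :
  run c1 s T1 Q1 -> (forall s1, Q1 s1 -> run c2 s1 T2 Q) ->
  run (Seq c1 c2) s (T1 + T2) Q.
Proof.
move=> [t1 [s1 [x1 l1 /[swap] /[apply] -[t2 [s2 [x2 l2 q]]]]]].
by exists (t1 + t2), s2; split=> //; [exact: ExecSeq x2 | exact: leq_add].
Qed.

Lemma run_if e c1 c2 s T (Q : state n -> Prop) :
  (eval w s e != 0 -> run c1 s T Q) -> (eval w s e = 0 -> run c2 s T Q) ->
  run (If e c1 c2) s (ecost e + T).+1 Q.
Proof.
move=> h1 h2.
have [t [s' [x l q]]] : run (if eval w s e != 0 then c1 else c2) s T Q.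
  by case: eqP => /= [/h2|/eqP/h1].
by exists (ecost e + t).+1, s'; split; [constructor | rewrite ltnS leq_add2l |].
Qed.

(** [I j] describes the state after [j] passes, and the number [k] of passes is known beforehand.
    The last summand pays for the final, failing test. *)
Lemma run_while e c s T k (I : nat -> state n -> Prop) :
  I 0 s ->
  (forall j s, j < k -> I j s -> eval w s e <> 0 /\ run c s T (I j.+1)) ->
  (forall s, I k s -> eval w s e = 0) ->
  run (While e c) s ((ecost e + T).+1 * k + (ecost e).+1) (I k).
Proof.
move=> I0 IS Ik.
(* Induction on the number [d] of passes that remain. *)
suff {I0} H : forall d j s, j + d = k -> I j s ->
    run (While e c) s ((ecost e + T).+1 * d + (ecost e).+1) (I k).
  exact: H I0.
elim=> [|d IHd] j {}s.
  rewrite addn0 => -> Is; exists (ecost e).+1, s.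
  by split; [apply: ExecWhileFalse; exact: Ik | rewrite muln0 | ].
move=> jd Ij; have jk : j < k by lia.
have [ne [t [s' [x l Ij']]]] := IS j s jk Ij.
have [t' [s'' [x' l' q]]] := IHd j.+1 s' (etrans (addSnnS j d) jd) Ij'.
exists (ecost e + t + t').+1, s''; split=> //; first exact: ExecWhileTrue x x'.
by rewrite mulnS; lia.
Qed.

End Execution.

(** * The programs *)

(* Registers: 4 bucket size, 5 loop counter of [init_arcs], 6 and 7 tail and
   head of the current arc, 8 bucket of the head, 9 position of the neighbour
   visited by [for_bucket], 10 this neighbour, 11 the partner of the tail.
   The memory is divided into regions of [n ^ 3] cells indexed by triples.
   Regions 1 to 3 hold the sets [W p x] under the keys [(p, x)], regions 4 to 6
   the neighbours of [v] in the bucket [i] under the keys [(v, i)]. *)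

Definition addr_expr (t : nat) (ea eb ec : expr) : expr :=
  let pair e e' := Bin OpAdd (Bin OpMul e (Reg 0)) e' in
  pair (pair (pair (Const t) ea) eb) ec.

Definition load r t ea eb ec := Assign r (Read (addr_expr t ea eb ec)).
Definition store t ea eb ec e := Write (addr_expr t ea eb ec) e.

(* The set with key [(a, b)] of the family [f] is an array without repetitions:
   region [f + 2] holds its elements, region [f + 3] its size, and region
   [f + 1] holds one plus the position of each element, and 0 elsewhere.
   Register 12 returns the encoded position of [x]. *)
Definition array_add f ra rb rx :=
  let a := Reg ra in let b := Reg rb in let x := Reg rx in
  Seq (load 12 (f + 3) a b (Const 0))
  (Seq (store (f + 2) a b (Reg 12) x)
  (Seq (Assign 12 (Bin OpAdd (Reg 12) (Const 1)))
  (Seq (store (f + 3) a b (Const 0) (Reg 12))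
       (store (f + 1) a b x (Reg 12))))).

(* The last element, returned in register 14, takes the place of [x]. *)
Definition array_remove f ra rb rx :=
  let a := Reg ra in let b := Reg rb in let x := Reg rx in
  Seq (load 12 (f + 1) a b x)
  (Seq (load 13 (f + 3) a b (Const 0))
  (Seq (Assign 13 (Bin OpSub (Reg 13) (Const 1)))
  (Seq (load 14 (f + 2) a b (Reg 13))
  (Seq (store (f + 2) a b (Bin OpSub (Reg 12) (Const 1)) (Reg 14))
  (Seq (store (f + 1) a b (Reg 14) (Reg 12))
  (Seq (store (f + 1) a b x (Const 0))
       (store (f + 3) a b (Const 0) (Reg 13)))))))).

(* Region 7 flags the arcs that put their edge into the spanner; an edge has to
   stay there as long as one of its two arcs is flagged. *)
Definition set_flag rv rx e :=
  let v := Reg rv in let x := Reg rx in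
  Seq (store 7 v x (Const 0) e)
  (If (Read (addr_expr 7 v x (Const 0))) (OutInsert v x)
  (If (Read (addr_expr 7 x v (Const 0))) (OutInsert v x) (OutDelete v x))).

(* The arc from [v] to [x] is flagged if [x] is the partner of [v] or [v] is the
   first element of [W p x]. *)
Definition flag_expr :=
  Bin OpLt (Const 0)
    (Bin OpAdd (Bin OpEq (Reg 11) (Reg 10)) (Bin OpEq (Reg 12) (Const 1))).

Definition witness_add :=
  Seq (array_add 0 11 10 6) (set_flag 6 10 flag_expr).

Definition witness_remove :=
  Seq (array_remove 0 11 10 6)
  (Seq (set_flag 14 10 flag_expr) (set_flag 6 10 (Const 0))).

(** The partner loaded into register 11 is the first element of the array of neighbours; the loop
    never alters this array. *)
Definition for_bucket body :=
  Seq (Assign 9 (Const 0))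
  (While (Bin OpLt (Reg 9) (Read (addr_expr 6 (Reg 6) (Reg 8) (Const 0))))
    (Seq (load 10 5 (Reg 6) (Reg 8) (Reg 9))
    (Seq (load 11 5 (Reg 6) (Reg 8) (Const 0))
    (Seq body
         (Assign 9 (Bin OpAdd (Reg 9) (Const 1))))))).

Definition arc_update :=
  Seq (Assign 8 (Bin OpDiv (Reg 7) (Reg 4)))
  (Seq (for_bucket witness_remove)
  (Seq (If (Reg 1) (array_add 3 6 8 7) (array_remove 3 6 8 7))
       (for_bucket witness_add))).

Definition edge_update :=
  Seq (Seq (Assign 6 (Reg 2)) (Assign 7 (Reg 3)))
  (Seq arc_update
  (Seq (Seq (Assign 6 (Reg 3)) (Assign 7 (Reg 2)))
       arc_update)).

Definition init_size :=
  While (Bin OpLt (Bin OpMul (Reg 4) (Reg 4)) (Reg 0))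
    (Assign 4 (Bin OpAdd (Reg 4) (Const 1))).

(** Register 5 runs through the row-major matrix, which contains every edge twice, once for each of
    its arcs. *)
Definition init_arc :=
  If (Read (Reg 5))
    (Seq (Seq (Assign 6 (Bin OpDiv (Reg 5) (Reg 0)))
              (Assign 7 (Bin OpMod (Reg 5) (Reg 0))))
         arc_update)
    Skip.

Definition init_arcs :=
  While (Bin OpLt (Reg 5) (Bin OpMul (Reg 0) (Reg 0)))
    (Seq init_arc (Assign 5 (Bin OpAdd (Reg 5) (Const 1)))).

Definition init := Seq init_size (Seq (Assign 1 (Const 1)) init_arcs).

Arguments addr_expr : simpl never.

(** * Addresses as numbers in base [n] *)

Section Memory.
Context (n : nat).

(* Region 0 is the input adjacency matrix, as [addr 0 0 v x = v * n + x]. *)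
Definition addr t a b c := ((t * n + a) * n + b) * n + c.

Lemma mulDn_inj a b a' b' : b < n -> b' < n ->
  a * n + b = a' * n + b' -> a = a' /\ b = b'.
Proof.
move=> bn b'n e; have n0 : 0 < n by lia.
have := congr1 (divn^~ n) e; have := congr1 (modn^~ n) e.
by rewrite /= !modnMDl !modn_small // !divnMDl // !divn_small // !addn0.
Qed.

Definition mem_cell (m : nat -> nat) t a b c := m (addr t a b c).

(** Addresses are injective because [a], [b] and [c] are digits in base [n]; the region is the
    leading coefficient and needs no bound. *)
Lemma cell_upd m t a b c x t' a' b' c' :
  a < n -> b < n -> c < n -> a' < n -> b' < n -> c' < n ->
  mem_cell (upd m (addr t a b c) x) t' a' b' c' =
  if [&& t' == t, a' == a, b' == b & c' == c] then x else mem_cell m t' a' b' c'.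
Proof.
move=> *; rewrite /mem_cell /upd; case: ifPn => [/eqP|ne].
  by do 3!(case/mulDn_inj => //); move=> -> -> -> ->; rewrite !eqxx.
by case: and4P ne => // -[/eqP-> /eqP-> /eqP-> /eqP->]; rewrite eqxx.
Qed.

End Memory.

(** * Finite sets stored as arrays with positions *)

Lemma leq_inj_size (T : eqType) (f : nat -> T) c (s : seq T) :
  (forall i j, i < c -> j < c -> f i = f j -> i = j) ->
  (forall j, j < c -> f j \in s) -> c <= size s.
Proof.
move=> finj fs; rewrite -(size_iota 0 c) -(size_map f); apply: uniq_leq_size.
  by rewrite map_inj_in_uniq ?iota_uniq // => i j; rewrite !mem_iota; exact: finj.
by move=> _ /mapP[j /[!mem_iota] jc ->]; exact: fs.
Qed.

Section Arrays.
Context (n : nat).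

(** [pos] and [elem] are inverse to each other up to the shift by one. Entries of [elem] from index
    [cnt] on are arbitrary, so a removal need not erase them. *)
Definition array_ok (pos elem : nat -> nat) (cnt : nat) :=
  (forall x, x < n -> 0 < pos x -> pos x <= cnt /\ elem (pos x).-1 = x) /\
  (forall j, j < cnt -> elem j < n /\ pos (elem j) = j.+1).

Implicit Types (pos elem : nat -> nat) (cnt x : nat).

Lemma array_ok_inj pos elem cnt i j : array_ok pos elem cnt ->
  i < cnt -> j < cnt -> elem i = elem j -> i = j.
Proof. by case=> _ h /h[_ ei] /h[_ ej] e; move: ei; rewrite e ej => -[]. Qed.

Lemma array_ok_le pos elem cnt : array_ok pos elem cnt -> cnt <= n.
Proof.
move=> ok; rewrite -(size_iota 0 n).
apply: (@leq_inj_size _ elem) => [i j|j jc]; first exact: array_ok_inj ok.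
by rewrite mem_iota; have [] := ok.2 j jc.
Qed.

(** By the pigeonhole principle, an absent element leaves room: the index [cnt] at which it gets
    appended is still a valid coordinate. *)
Lemma array_ok_lt pos elem cnt x : array_ok pos elem cnt ->
  x < n -> pos x = 0 -> cnt < n.
Proof.
move=> ok xn px.
have : cnt <= size (rem x (iota 0 n)).
  apply: (@leq_inj_size _ elem) => [i j|j jc]; first exact: array_ok_inj ok.
  have [jn pj] := (proj2 ok) j jc.
  rewrite mem_rem_uniq ?iota_uniq // inE /= mem_iota jn.
  by case: eqP => // e; move: pj; rewrite e px.
by rewrite size_rem ?mem_iota // size_iota; lia.
Qed.

Lemma array_ok_add pos elem cnt x pos' elem' : array_ok pos elem cnt ->
  x < n -> pos x = 0 ->
  (forall y, y < n -> pos' y = if y == x then cnt.+1 else pos y) ->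
  (forall j, j < n -> elem' j = if j == cnt then x else elem j) ->
  array_ok pos' elem' cnt.+1.
Proof.
move=> ok xn px Hp He; have cn := array_ok_lt ok xn px; case: (ok) => ok1 ok2.
split=> [y yn|j jc].
  rewrite Hp //; case: eqP => [->|ne] py; first by rewrite /= He // eqxx.
  have [le ej] := ok1 y yn py; rewrite leqW // He; last by lia.
  by case: eqP; [lia | rewrite ej].
rewrite He; last by lia.
case: eqP => [->|ne]; first by rewrite Hp // eqxx.
have [jn pj] := ok2 j ltac:(lia); rewrite Hp //; split=> //.
by case: eqP => // e; move: pj; rewrite e px.
Qed.

(** The last element may be [x] itself. Testing [y == x] first then gives position 0, in agreement
    with the program, which erases the position of [x] after it has moved the last element. *)
Lemma array_ok_remove pos elem cnt x pos' elem' : array_ok pos elem cnt ->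
  x < n -> 0 < pos x -> cnt <= n ->
  (forall y, y < n -> pos' y =
     if y == x then 0 else if y == elem cnt.-1 then pos x else pos y) ->
  (forall j, j < n -> elem' j = if j == (pos x).-1 then elem cnt.-1 else elem j) ->
  array_ok pos' elem' cnt.-1.
Proof.
move=> ok xn px cn Hp He; case: (ok) => ok1 ok2.
have [le ex] := ok1 x xn px; have [ln pl] := ok2 cnt.-1 ltac:(lia).
split=> [y yn|j jc].
  rewrite Hp //; case: eqP => // nx; case: eqP => [yl _|nl py].
    have ne : pos x <> cnt by move=> e; apply: nx; rewrite yl -e.
    by rewrite He ?eqxx; [split=> //; lia | lia].
  have [le' ey] := ok1 y yn py.
  have ne : pos y <> cnt by move=> e; apply: nl; rewrite -ey e.
  split; first by lia.
  rewrite He; last by lia.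
  by case: eqP => // e; case: nx; rewrite -ex -e.
rewrite He; last by lia.
case: eqP => [e|ne].
  rewrite Hp // eqxx; split=> //; case: eqP => e'; last by lia.
  by move: pl; rewrite e'; lia.
have [jn pj] := ok2 j ltac:(lia); split=> //; rewrite Hp //.
case: eqP => [e|nx]; first by move: pj; rewrite e; lia.
by case: eqP => // e; move: pj; rewrite e pl; lia.
Qed.

End Arrays.

(** * Invariants of the sets [W p x], of the flags and of the output *)

Section Invariants.
Context (n : nat).
Implicit Types s : state n.
Local Notation cell := (mem_cell n).

Definition in_array (f a b t a' b' : nat) := [&& f < t <= f + 3, a' == a & b' == b].

Definition array_at m f a b :=
  array_ok n (cell m (f + 1) a b) (cell m (f + 2) a b) (cell m (f + 3) a b 0).

(** Equality at coordinates below [n] suffices, because an array has at most [n] elements. *)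
Lemma array_at_frame m m' f a b : 0 < n ->
  (forall t c, f < t <= f + 3 -> c < n -> cell m' t a b c = cell m t a b c) ->
  array_at m f a b -> array_at m' f a b.
Proof.
move=> n0 E ok; have le := array_ok_le ok; case: ok => h1 h2.
rewrite /array_at (E (f + 3)) //; last by lia.
split=> [y yn|j jc].
  rewrite E //; last by lia.
  by move=> py; have [le' e] := h1 y yn py; rewrite E //; lia.
by have [ejn pj] := h2 j jc; rewrite (E (f + 2)) ?(E (f + 1)) //; lia.
Qed.

(** Registers from 12 on are the scratch space of the array operations. *)
Lemma upd_lt (g : nat -> nat) k x r : r < 12 -> 12 <= k -> upd g k x r = g r.
Proof. by move=> r12 k12; rewrite /upd; case: eqP => //; lia. Qed.

Definition out_ok s := forall e : {set 'I_n}, e \in out s <->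
  exists v x, [/\ v < n, x < n, 0 < cell (mem s) 7 v x 0 & e = word_edge n v x].

Lemma word_edgeC v x : word_edge n v x = word_edge n x v.
Proof. by apply/setP => y; rewrite !inE orbC. Qed.

Lemma word_edge_inj v x v' x' : v < n -> x < n -> v' < n -> x' < n ->
  word_edge n v x = word_edge n v' x' ->
  v = v' /\ x = x' \/ v = x' /\ x = v'.
Proof.
move=> vn xn v'n x'n /setP e.
move: (e (Ordinal vn)) (e (Ordinal xn)) (e (Ordinal v'n)) (e (Ordinal x'n)).
by rewrite !inE /= !eqxx ?orbT; lia.
Qed.

(* [P v x p]: the vertex [v] belongs to the set [W p x]. *)
Definition triple_pred := nat -> nat -> nat -> Prop.

(** The relation [P] is a parameter because the sets are only partly filled during the two passes of
    an arc update. A flag is indexed by the arc alone; [witness_uniq] makes this meaningful, as the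
    arc determines the [p] that [witness_flag] refers to. *)
Record witness_ok (P : triple_pred) s : Prop := WitnessOk {
  witness_array : forall p x, p < n -> x < n -> array_at (mem s) 0 p x;
  witness_mem : forall v x p, v < n -> x < n -> p < n ->
    0 < cell (mem s) 1 p x v <-> P v x p;
  witness_uniq : forall v x p p', v < n -> x < n -> p < n -> p' < n ->
    0 < cell (mem s) 1 p x v -> 0 < cell (mem s) 1 p' x v -> p = p';
  witness_flag : forall v x p, v < n -> x < n -> p < n ->
    0 < cell (mem s) 1 p x v ->
    cell (mem s) 7 v x 0 = (p == x) || (cell (mem s) 1 p x v == 1);
  witness_unflag : forall v x, v < n -> x < n -> 0 < cell (mem s) 7 v x 0 ->
    exists2 p, p < n & 0 < cell (mem s) 1 p x v;
  witness_out : out_ok s }.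

Lemma witness_ok_iff (P P' : triple_pred) s :
  (forall v x p, v < n -> x < n -> p < n -> P v x p <-> P' v x p) ->
  witness_ok P s -> witness_ok P' s.
Proof.
move=> PP' [? wm ? ? ? ?]; split=> // v x p vn xn pn.
by rewrite -PP' //; exact: wm.
Qed.

Lemma witness_ok_frame P s s' :
  (forall t a b c, a < n -> b < n -> c < n -> (t <= 3) || (t == 7) ->
    cell (mem s') t a b c = cell (mem s) t a b c) ->
  out s' = out s -> witness_ok P s -> witness_ok P s'.
Proof.
move=> E oE [wa wm wu wf wv wo]; split.
- move=> p x pn xn; apply: array_at_frame (wa p x pn xn) => [|t c t3 cn]; first by lia.
  by rewrite E //; lia.
- by move=> v x p vn xn pn; rewrite E //; exact: wm.
- by move=> v x p p' vn xn pn p'n; rewrite !E //; exact: wu.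
- by move=> v x p vn xn pn; have n0 : 0 < n by [lia]; rewrite !E //; exact: wf.
- move=> v x vn xn; have n0 : 0 < n by lia.
  by rewrite E // => /(wv v x vn xn)[p pn h]; exists p; rewrite ?E.
- move=> e; rewrite oE wo.
  split=> -[v [x [vn xn h ee]]]; have n0 : 0 < n by [lia | lia];
    exists v, x; split=> //; by [rewrite E | rewrite E in h].
Qed.

(** Only the sets [W p x] and the flags may change, so the neighbour arrays that drive the loops,
    and the input matrix, stay fixed. *)
Definition frame s s' := forall t a b c, a < n -> b < n -> c < n ->
  ~~ (0 < t <= 3) -> t != 7 -> cell (mem s') t a b c = cell (mem s) t a b c.

Definition effect (P : triple_pred) s s' := [/\ witness_ok P s',
  forall r, r < 12 -> reg s' r = reg s r & frame s s'].

End Invariants.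

(** * Effect of the loop-free programs, without overflow *)

Section Semantics.
Context (n w : nat) (hw : 8 * n.+1 ^ 3 <= 2 ^ w).
Implicit Types (s : state n) (e : expr).
Local Notation cell := (mem_cell n).
Local Notation addr := (addr n).
Local Notation array_at := (array_at n).

Lemma small_word k : k <= n * n + 2 -> k < 2 ^ w.
Proof. by move=> kn; apply: leq_trans hw; rewrite !expnS expn0; nia. Qed.

Lemma eval_add s e1 e2 : eval w s e1 + eval w s e2 < 2 ^ w ->
  eval w s (Bin OpAdd e1 e2) = eval w s e1 + eval w s e2.
Proof. exact: modn_small. Qed.

Lemma eval_mul s e1 e2 : eval w s e1 * eval w s e2 < 2 ^ w ->
  eval w s (Bin OpMul e1 e2) = eval w s e1 * eval w s e2.
Proof. exact: modn_small. Qed.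

Lemma eval_sub s e1 e2 : eval w s e2 <= eval w s e1 -> eval w s e1 < 2 ^ w ->
  eval w s (Bin OpSub e1 e2) = eval w s e1 - eval w s e2.
Proof.
move=> le lt; rewrite /= /binop_sem -addnBAC // modnDr modn_small //.
by apply: leq_ltn_trans lt; exact: leq_subr.
Qed.

Lemma eval_const s k : k <= n * n + 2 -> eval w s (Const k) = k.
Proof. by move=> /small_word; exact: modn_small. Qed.

Lemma eval_bool s e1 e2 :
  eval w s (Bin OpLt e1 e2) = (eval w s e1 < eval w s e2) /\
  eval w s (Bin OpEq e1 e2) = (eval w s e1 == eval w s e2).
Proof.
have h (b : bool) : b < 2 ^ w by apply: small_word; case: b => /=; lia.
by split; rewrite /= /binop_sem modn_small ?h.
Qed.

(** With eight regions every address is below [8 * n ^ 3], which fits into a word by [hw]. *)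
Lemma eval_addr s t ea eb ec a b c : reg s 0 = n -> t < 8 ->
  eval w s ea = a -> eval w s eb = b -> eval w s ec = c ->
  a < n -> b < n -> c < n -> eval w s (addr_expr t ea eb ec) = addr t a b c.
Proof.
move=> s0 t8 Ea Eb Ec an bn cn.
have nn : n <= n * n by nia.
have t1 : t * n < 8 * n by nia.
have t2 : (t * n + a) * n < 8 * n * n by nia.
have t3 : ((t * n + a) * n + b) * n + c < 8 * n * n * n by nia.
have t4 : 8 * n * n * n < 2 ^ w by apply: leq_trans hw; rewrite !expnS expn0; nia.
have Et : eval w s (Const t) = t by apply: modn_small; nia.
have E0 : eval w s (Reg 0) = n by [].
(* One Horner step in base [n]; it is applied once for each of the three coordinates. *)
have step e x y ex : eval w s e = x -> eval w s ex = y -> x * n + y < 2 ^ w ->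
    eval w s (Bin OpAdd (Bin OpMul e (Reg 0)) ex) = x * n + y.
  by move=> Ex Ey lt; rewrite eval_add !eval_mul ?Ex ?Ey ?E0 //; nia.
rewrite /addr_expr /addr; do 2!(apply: (step) => //; last by nia); apply: (step) => //; nia.
Qed.

Lemma eval_cell s t ea eb ec a b c : reg s 0 = n -> t < 8 ->
  eval w s ea = a -> eval w s eb = b -> eval w s ec = c ->
  a < n -> b < n -> c < n ->
  eval w s (Read (addr_expr t ea eb ec)) = cell (mem s) t a b c.
Proof. by move=> *; rewrite /mem_cell -(@eval_addr s t ea eb ec a b c). Qed.

Lemma sem_load s r t ea eb ec a b c : reg s 0 = n -> t < 8 ->
  eval w s ea = a -> eval w s eb = b -> eval w s ec = c ->
  a < n -> b < n -> c < n ->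
  sem w (load r t ea eb ec) s = set_reg s r (cell (mem s) t a b c).
Proof. by move=> *; rewrite /mem_cell -(@eval_addr s t ea eb ec a b c). Qed.

Lemma sem_store s t ea eb ec e a b c x : reg s 0 = n -> t < 8 ->
  eval w s ea = a -> eval w s eb = b -> eval w s ec = c ->
  a < n -> b < n -> c < n -> eval w s e = x ->
  sem w (store t ea eb ec e) s = set_mem s (addr t a b c) x.
Proof. by move=> *; rewrite -(@eval_addr s t ea eb ec a b c) //=; congr set_mem. Qed.

Lemma sem_assign s r e x : eval w s e = x ->
  sem w (Assign r e) s = set_reg s r x.
Proof. by move=> <-. Qed.

Lemma sem_seq c1 c2 s : sem w (Seq c1 c2) s = sem w c2 (sem w c1 s).
Proof. by []. Qed.

Lemma sem_if e c1 c2 s :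
  sem w (If e c1 c2) s = if eval w s e != 0 then sem w c1 s else sem w c2 s.
Proof. by []. Qed.

Lemma sem_array_add f ra rb rx s a b x :
  f < 5 -> ra < 12 -> rb < 12 -> rx < 12 -> reg s 0 = n ->
  reg s ra = a -> reg s rb = b -> reg s rx = x -> a < n -> b < n -> x < n ->
  let c := cell (mem s) (f + 3) a b 0 in c < n ->
  sem w (array_add f ra rb rx) s =
  State (upd (upd (reg s) 12 c) 12 c.+1)
    (upd (upd (upd (mem s) (addr (f + 2) a b c) x)
       (addr (f + 3) a b 0) c.+1) (addr (f + 1) a b x) c.+1) (out s).
Proof.
move=> f5 ra12 rb12 rx12 s0 sa sb sx an bn xn c cn.
have n0 : 0 < n by lia.
have z s' : eval w s' (Const 0) = 0 by rewrite eval_const.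
have o s' : eval w s' (Const 1) = 1 by rewrite eval_const //; lia.
rewrite /array_add !sem_seq (@sem_load s _ _ _ _ _ a b 0) //; last by lia.
rewrite -/c; set s1 := set_reg s 12 c.
have s10 : reg s1 0 = n by [].
have s1r r : r < 12 -> eval w s1 (Reg r) = reg s r by move=> h; exact: upd_lt.
rewrite (@sem_store s1 _ _ _ _ _ a b c x) ?(s1r ra) ?(s1r rb) ?(s1r rx) //; last by lia.
set s2 := set_mem s1 _ _.
rewrite (@sem_assign s2 _ _ c.+1); last first.
  have E : eval w s2 (Reg 12) = c by [].
  by rewrite eval_add o E addn1 //; apply: small_word; nia.
set s3 := set_reg s2 12 c.+1.
have s3r r : r < 12 -> eval w s3 (Reg r) = reg s r.
  by move=> h; rewrite /= !upd_lt.
rewrite (@sem_store s3 _ _ _ _ _ a b 0 c.+1) ?(s3r ra) ?(s3r rb) ?(s3r rx) //; last by lia.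
set s4 := set_mem s3 _ _.
have s4r r : r < 12 -> eval w s4 (Reg r) = reg s r by exact: s3r.
by rewrite (@sem_store s4 _ _ _ _ _ a b x c.+1) ?(s4r ra) ?(s4r rb) ?(s4r rx) //; lia.
Qed.

Lemma array_addP f ra rb rx s a b x :
  f < 5 -> ra < 12 -> rb < 12 -> rx < 12 -> reg s 0 = n ->
  reg s ra = a -> reg s rb = b -> reg s rx = x -> a < n -> b < n -> x < n ->
  array_at (mem s) f a b -> cell (mem s) (f + 1) a b x = 0 ->
  let s' := sem w (array_add f ra rb rx) s in
  let c := (cell (mem s) (f + 3) a b 0).+1 in
  [/\ array_at (mem s') f a b,
      forall y, y < n -> cell (mem s') (f + 1) a b y =
        if y == x then c else cell (mem s) (f + 1) a b y,
      reg s' 12 = c /\ (forall r, r < 12 -> reg s' r = reg s r),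
      out s' = out s &
      forall t a' b' c', a' < n -> b' < n -> c' < n ->
        ~~ in_array f a b t a' b' -> cell (mem s') t a' b' c' = cell (mem s) t a' b' c'].
Proof.
move=> f5 ra12 rb12 rx12 s0 sa sb sx an bn xn ok px s' c.
have cn := array_ok_lt ok xn px; have n0 : 0 < n by lia.
rewrite /s' (@sem_array_add f ra rb rx s a b x) // {s'} /= -/c.
have posE y : y < n -> cell (upd (upd (upd (mem s) (addr (f + 2) a b c.-1) x)
    (addr (f + 3) a b 0) c) (addr (f + 1) a b x) c) (f + 1) a b y =
    if y == x then c else cell (mem s) (f + 1) a b y.
  by move=> yn; rewrite !cell_upd // !eqn_add2l !eqxx.
split=> //.
- rewrite /array_at !cell_upd // !eqn_add2l !eqxx /=.
  apply: (array_ok_add ok xn px posE) => j jn.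
  by rewrite !cell_upd // !eqn_add2l !eqxx.
- by split=> // r h; rewrite !upd_lt.
- move=> t a' b' c' a'n b'n c'n nin; rewrite !cell_upd //.
  by do ![case: and4P => [[/eqP e /eqP e1 /eqP e2 _]|_];
    first by move: nin; rewrite /in_array e e1 e2 !eqxx; lia].
Qed.

Lemma sem_array_remove f ra rb rx s a b x :
  f < 5 -> ra < 12 -> rb < 12 -> rx < 12 -> reg s 0 = n ->
  reg s ra = a -> reg s rb = b -> reg s rx = x -> a < n -> b < n -> x < n ->
  let q := cell (mem s) (f + 1) a b x in
  let c := cell (mem s) (f + 3) a b 0 in
  let l := cell (mem s) (f + 2) a b c.-1 in
  0 < q -> q <= c -> c <= n -> l < n ->
  let s' := sem w (array_remove f ra rb rx) s in
  [/\ mem s' = upd (upd (upd (upd (mem s) (addr (f + 2) a b q.-1) l)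
       (addr (f + 1) a b l) q) (addr (f + 1) a b x) 0) (addr (f + 3) a b 0) c.-1,
      reg s' 12 = q, reg s' 14 = l,
      forall r, r < 12 -> reg s' r = reg s r & out s' = out s].
Proof.
move=> f5 ra12 rb12 rx12 s0 sa sb sx an bn xn q c l q0 qc cn ln.
have n0 : 0 < n by lia.
have z s' : eval w s' (Const 0) = 0 by rewrite eval_const.
have o s' : eval w s' (Const 1) = 1 by rewrite eval_const //; lia.
have [q1n c1n] : q.-1 < n /\ c.-1 < n by lia.
have [qw cw] : q < 2 ^ w /\ c < 2 ^ w by split; apply: small_word; nia.
rewrite /array_remove !sem_seq (@sem_load s _ _ _ _ _ a b x) //; last by lia.
rewrite -/q; set s1 := set_reg s 12 q.
have s1r r : r < 12 -> eval w s1 (Reg r) = reg s r by move=> h; exact: upd_lt.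
rewrite (@sem_load s1 _ _ _ _ _ a b 0) ?(s1r ra) ?(s1r rb) ?(s1r rx) //; last by lia.
rewrite [mem s1]/= -/c; set s2 := set_reg s1 13 c.
rewrite (@sem_assign s2 _ _ c.-1); last first.
  have E : eval w s2 (Reg 13) = c by [].
  by rewrite eval_sub ?o ?E ?subn1 //; lia.
set s3 := set_reg s2 13 c.-1.
have s3r r : r < 12 -> eval w s3 (Reg r) = reg s r.
  by move=> h; rewrite /= !upd_lt.
rewrite (@sem_load s3 _ _ _ _ _ a b c.-1) ?(s3r ra) ?(s3r rb) ?(s3r rx) //; last by lia.
rewrite [mem s3]/= -/l; set s4 := set_reg s3 14 l.
have s4r r : r < 12 -> eval w s4 (Reg r) = reg s r.
  by move=> h; rewrite /= !upd_lt.
rewrite (@sem_store s4 _ _ _ _ _ a b q.-1 l) ?(s4r ra) ?(s4r rb) ?(s4r rx) //; first last.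
- have E : eval w s4 (Reg 12) = q by [].
  by rewrite eval_sub ?o ?E ?subn1.
- by lia.
set s5 := set_mem s4 _ _.
have s5r r : r < 12 -> eval w s5 (Reg r) = reg s r by exact: s4r.
rewrite (@sem_store s5 _ _ _ _ _ a b l q) ?(s5r ra) ?(s5r rb) ?(s5r rx) //; last by lia.
set s6 := set_mem s5 _ _.
have s6r r : r < 12 -> eval w s6 (Reg r) = reg s r by exact: s4r.
rewrite (@sem_store s6 _ _ _ _ _ a b x 0) ?(s6r ra) ?(s6r rb) ?(s6r rx) //; last by lia.
set s7 := set_mem s6 _ _.
have s7r r : r < 12 -> eval w s7 (Reg r) = reg s r by exact: s4r.
rewrite (@sem_store s7 _ _ _ _ _ a b 0 c.-1) ?(s7r ra) ?(s7r rb) ?(s7r rx) //; lia.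
Qed.

(** The witness [l] is the element moved into the gap, possibly [x] itself. Its membership before
    the removal is recorded for the sake of the flags: it identifies the set to which the flag of
    [l] refers. *)
Lemma array_removeP f ra rb rx s a b x :
  f < 5 -> ra < 12 -> rb < 12 -> rx < 12 -> reg s 0 = n ->
  reg s ra = a -> reg s rb = b -> reg s rx = x -> a < n -> b < n -> x < n ->
  array_at (mem s) f a b -> 0 < cell (mem s) (f + 1) a b x ->
  let s' := sem w (array_remove f ra rb rx) s in
  let q := cell (mem s) (f + 1) a b x in
  exists l, [/\
      [/\ l < n, reg s' 12 = q, reg s' 14 = l & forall r, r < 12 -> reg s' r = reg s r],
      array_at (mem s') f a b,
      0 < cell (mem s) (f + 1) a b l /\ forall y, y < n ->
        cell (mem s') (f + 1) a b y =
        if y == x then 0 else if y == l then q else cell (mem s) (f + 1) a b y,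
      out s' = out s &
      forall t a' b' c', a' < n -> b' < n -> c' < n ->
        ~~ in_array f a b t a' b' -> cell (mem s') t a' b' c' = cell (mem s) t a' b' c'].
Proof.
move=> f5 ra12 rb12 rx12 s0 sa sb sx an bn xn ok q0 s' q.
set c := cell (mem s) (f + 3) a b 0.
set l := cell (mem s) (f + 2) a b c.-1.
have [qc _] := ok.1 x xn q0; have n0 : 0 < n by lia.
have cn : c <= n := array_ok_le ok.
have [ln pl] := ok.2 c.-1 ltac:(lia); have q1n : q.-1 < n by lia.
have [] := @sem_array_remove f ra rb rx s a b x f5 ra12 rb12 rx12 s0 sa sb sx
  an bn xn q0 qc cn ln.
rewrite -/s' -/q -/c -/l => m' s'12 s'14 s'r s'o.
have posE y : y < n -> cell (mem s') (f + 1) a b y =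
    if y == x then 0 else if y == l then q else cell (mem s) (f + 1) a b y.
  by move=> yn; rewrite m' !cell_upd // !eqn_add2l !eqxx.
exists l; split=> //.
- rewrite /array_at; have -> : cell (mem s') (f + 3) a b 0 = c.-1.
    by rewrite m' !cell_upd // !eqxx.
  apply: (array_ok_remove ok xn q0 cn posE) => j jn.
  by rewrite m' !cell_upd // !eqn_add2l !eqxx.
- by rewrite pl.
- move=> t a' b' c' a'n b'n c'n nin; rewrite m' !cell_upd //.
  by do ![case: and4P => [[/eqP e /eqP e1 /eqP e2 _]|_];
    first by move: nin; rewrite /in_array e e1 e2 !eqxx; lia].
Qed.

(** The edge is shared by two arcs, so after the store both flags are read and the edge leaves the
    output only if both are 0. *)
Lemma set_flagP rv rx e s v x : reg s 0 = n -> reg s rv = v -> reg s rx = x ->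
  v < n -> x < n -> out_ok s ->
  let s' := sem w (set_flag rv rx e) s in
  [/\ reg s' = reg s, mem s' = upd (mem s) (addr 7 v x 0) (eval w s e) & out_ok s'].
Proof.
move=> s0 sv sx vn xn ok s'; have n0 : 0 < n by lia.
have z s'' : eval w s'' (Const 0) = 0 by rewrite eval_const.
move: @s'; rewrite /set_flag sem_seq (@sem_store s _ _ _ _ _ v x 0 (eval w s e)) //.
set b := eval w s e; set s1 := set_mem s _ _.
set c := cell (mem s1) 7.
have cE v' x' : v' < n -> x' < n -> c v' x' 0 =
    if (v' == v) && (x' == x) then b else cell (mem s) 7 v' x' 0.
  by move=> v'n x'n; rewrite /c cell_upd // !eqxx andbT.
have E s2 : sem w (If (Read (addr_expr 7 (Reg rv) (Reg rx) (Const 0)))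
    (OutInsert (Reg rv) (Reg rx))
    (If (Read (addr_expr 7 (Reg rx) (Reg rv) (Const 0)))
       (OutInsert (Reg rv) (Reg rx)) (OutDelete (Reg rv) (Reg rx)))) s1 = s2 ->
    s2 = set_out s1 (if (0 < c v x 0) || (0 < c x v 0)
      then out s :|: [set word_edge n v x] else out s :\: [set word_edge n v x]).
  move=> <-; rewrite !sem_if (@eval_cell s1 7 _ _ _ v x 0) //.
  rewrite (@eval_cell s1 7 _ _ _ x v 0) // -!lt0n -/c.
  by case: (0 < c v x 0) => //; case: (0 < c x v 0); rewrite /= sv sx.
rewrite (E _ erefl); split=> // e' /=.
split.
- move=> ine.
  have [ee|ne] := eqVneq e' (word_edge n v x).
    move: ine; rewrite ee; case: ifP => [/orP[h|h] _|_]; [by exists v, x | | by rewrite !inE eqxx].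
    by exists x, v; rewrite word_edgeC.
  have : e' \in out s by move: ine; case: ifP; rewrite !inE (negPf ne) ?orbF.
  case/ok => v' [x' [v'n x'n h e'E]]; exists v', x'; split=> //.
  rewrite [X in 0 < X]cE //; case: andP => // -[/eqP e1 /eqP e2].
  by move: ne; rewrite e'E e1 e2 eqxx.
- case=> v' [x' [v'n x'n h e'E]].
  have [ee|ne] := eqVneq e' (word_edge n v x).
    suff -> : (0 < c v x 0) || (0 < c x v 0) by rewrite ee !inE eqxx orbT.
    move: h; rewrite -/(c v' x' 0).
    have := word_edge_inj v'n x'n vn xn (etrans (esym e'E) ee).
    by case=> -[-> ->] ->; rewrite ?orbT.
  have ino : e' \in out s.
    apply/ok; exists v', x'; split=> //; move: h; rewrite -/(c v' x' 0) cE //.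
    by case: andP => // -[/eqP e1 /eqP e2]; move: ne; rewrite e'E e1 e2 eqxx.
  by case: ifP; rewrite !inE ino ?ne.
Qed.

Lemma eval_flag_expr s :
  eval w s flag_expr = (reg s 11 == reg s 10) || (reg s 12 == 1).
Proof.
have z : eval w s (Const 0) = 0 by rewrite eval_const.
have o : eval w s (Const 1) = 1 by rewrite eval_const //; lia.
rewrite /flag_expr (eval_bool _ _ _).1 z eval_add !(eval_bool _ _ _).2 o /=;
  first by do 2!case: eqP.
by apply: small_word; do 2!case: eqP => _; rewrite /=; lia.
Qed.

(** Appending moves no element of the array, so only the flag of the new arc has to be set. The last
    hypothesis preserves [witness_uniq]. *)
Lemma witness_addP P s v x p : reg s 0 = n -> reg s 6 = v -> reg s 10 = x ->
  reg s 11 = p -> v < n -> x < n -> p < n -> witness_ok P s ->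
  (forall p', p' < n -> ~ P v x p') ->
  effect (fun v' x' p' => P v' x' p' \/ [/\ v' = v, x' = x & p' = p])
    s (sem w witness_add s).
Proof.
move=> s0 s6 s10 s11 vn xn pn ok nP; case: (ok) => wa wm wu wf wv wo.
have n0 : 0 < n by lia.
have nP' p' : p' < n -> cell (mem s) 1 p' x v = 0.
  by move=> p'n; apply/eqP; rewrite -leqn0 leqNgt; apply/negP=> /wm h; apply: nP (h _ _ _).
rewrite /witness_add sem_seq.
have := @array_addP 0 11 10 6 s p x v isT isT isT isT s0 s11 s10 s6 pn xn vn
  (wa p x pn xn) (nP' p pn).
set s1 := sem w (array_add 0 11 10 6) s; rewrite !add0n.
set c := (cell (mem s) 3 p x 0).+1 => -[a1 pos1 [r12 r1] o1 f1].
have posE v' x' p' : v' < n -> x' < n -> p' < n -> cell (mem s1) 1 p' x' v' =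
    if [&& v' == v, x' == x & p' == p] then c else cell (mem s) 1 p' x' v'.
  move=> v'n x'n p'n; case: and3P => [[/eqP-> /eqP-> /eqP->]|ne].
    by rewrite pos1 // eqxx.
  have [/andP[/eqP e1 /eqP e2]|ne'] := boolP ((p' == p) && (x' == x)).
    rewrite e1 e2 pos1 //; case: eqP => // e3.
    by case: ne; rewrite e1 e2 e3 !eqxx.
  by rewrite f1 //; rewrite /in_array (negPf ne') andbF.
have o1k : out_ok s1.
  move=> e; rewrite o1 wo.
  by split=> -[v' [x' [v'n x'n h ee]]]; exists v', x'; split=> //; rewrite f1 // in h *.
have s10' : reg s1 0 = n by rewrite r1.
have s16 : reg s1 6 = v by rewrite r1.
have s110 : reg s1 10 = x by rewrite r1.
have [r2 m2 o2] := set_flagP flag_expr s10' s16 s110 vn xn o1k.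
rewrite eval_flag_expr r1 // s11 r1 // s10 r12 in m2.
set s2 := sem w _ s1 in r2 m2 o2 *; set b := nat_of_bool _ in m2.
have f2 t a' b' c' : a' < n -> b' < n -> c' < n -> t != 7 ->
    cell (mem s2) t a' b' c' = cell (mem s1) t a' b' c'.
  by move=> a'n b'n c'n t7; rewrite m2 cell_upd // (negPf t7).
have flagE v' x' : v' < n -> x' < n -> cell (mem s2) 7 v' x' 0 =
    if (v' == v) && (x' == x) then b else cell (mem s) 7 v' x' 0.
  by move=> v'n x'n; rewrite m2 cell_upd // eqxx andbT f1.
split.
- split=> //.
  + move=> p' x' p'n x'n.
    have [/andP[/eqP e1 /eqP e2]|ne'] := boolP ((p' == p) && (x' == x)).
      by rewrite e1 e2; apply: array_at_frame a1 => // t c' t3 c'n; rewrite f2 //; lia.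
    apply: array_at_frame (wa p' x' p'n x'n) => // t c' t3 c'n.
    by rewrite f2 ?f1 // ?/in_array ?(negPf ne') ?andbF //; lia.
  + move=> v' x' p' v'n x'n p'n; rewrite f2 // posE //.
    case: and3P => [[/eqP e1 /eqP e2 /eqP e3]|ne]; first by split=> // _; right.
    rewrite wm //; split=> [|[//|[e1 e2 e3]]]; first by left.
    by case: ne; rewrite e1 e2 e3 !eqxx.
  + move=> v' x' p1 p2 v'n x'n p1n p2n; rewrite !f2 // !posE //.
    have [/andP[/eqP -> /eqP ->]|ne] := boolP ((v' == v) && (x' == x)).
      rewrite !eqxx /=.
      by case: (p1 =P p) => [->|_]; case: (p2 =P p) => [->|_]; rewrite ?nP'.
    by rewrite !andbA (negPf ne) /=; exact: wu.
  + move=> v' x' p' v'n x'n p'n; rewrite f2 // flagE // posE //.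
    rewrite andbA; have [/andP[/eqP -> /eqP ->]|ne] := boolP ((v' == v) && (x' == x)).
      by case: (p' =P p) => [->|_] /=; rewrite ?eqxx ?nP'.
    exact: wf.
  + move=> v' x' v'n x'n; rewrite flagE //; case: andP => [[/eqP-> /eqP->] _|ne].
      by exists p => //; rewrite f2 // posE // !eqxx.
    case/wv=> // p' p'n h; exists p' => //; rewrite f2 // posE // andbA.
    by case: andP.
- by move=> r r12'; rewrite r2 r1.
- move=> t a' b' c' a'n b'n c'n nt t7; rewrite f2 // f1 // /in_array.
  by rewrite (negPf nt).
Qed.

End Semantics.

(** * Removal from a set [W p x], and the loop over a bucket *)

Section ArcUpdate.
Context (n w : nat) (hw : 8 * n.+1 ^ 3 <= 2 ^ w).
Implicit Types (s : state n) (e : expr).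
Local Notation cell := (mem_cell n).
Local Notation array_at := (array_at n).

(** The element [l] that takes the place of [v] may become the first one, so its flag is recomputed
    from its new position [q]. The flag of [v] is cleared afterwards, which is the right order also
    when [l] is [v]. *)
Lemma witness_removeP P s v x p : reg s 0 = n -> reg s 6 = v -> reg s 10 = x ->
  reg s 11 = p -> v < n -> x < n -> p < n -> witness_ok P s -> P v x p ->
  effect (fun v' x' p' => P v' x' p' /\ ~ [/\ v' = v, x' = x & p' = p])
    s (sem w witness_remove s).
Proof.
move=> s0 s6 s10 s11 vn xn pn ok Pvxp; case: (ok) => wa wm wu wf wv wo.
have n0 : 0 < n by lia.
have q0 : 0 < cell (mem s) 1 p x v by apply/wm.
rewrite /witness_remove 2!sem_seq.
have := @array_removeP n w hw 0 11 10 6 s p x v isT isT isT isT s0 s11 s10 s6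
  pn xn vn (wa p x pn xn) q0.
set s1 := sem w (array_remove 0 11 10 6) s; rewrite !add0n.
set q := cell (mem s) 1 p x v in q0 * => -[l [[ln r12 r14 r1] a1 [pl pos1] o1 f1]].
clearbody s1.
have posE v' x' p' : v' < n -> x' < n -> p' < n -> cell (mem s1) 1 p' x' v' =
    if (p' == p) && (x' == x) then
      if v' == v then 0 else if v' == l then q else cell (mem s) 1 p' x' v'
    else cell (mem s) 1 p' x' v'.
  move=> v'n x'n p'n; have [/andP[/eqP -> /eqP ->]|ne] := boolP ((p' == p) && (x' == x)).
    by rewrite pos1.
  by rewrite f1 // /in_array (negPf ne) andbF.
have pos_le v' x' p' : v' < n -> x' < n -> p' < n ->
    0 < cell (mem s1) 1 p' x' v' -> 0 < cell (mem s) 1 p' x' v'.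
  move=> v'n x'n p'n; rewrite posE //; case: andP => [[/eqP -> /eqP ->]|//].
  by case: eqP => // _; case: eqP => [->|].
have o1k : out_ok s1.
  move=> e; rewrite o1 wo.
  by split=> -[v' [x' [v'n x'n h ee]]]; exists v', x'; split=> //; rewrite f1 // in h *.
have s10' : reg s1 0 = n by rewrite r1.
have s110 : reg s1 10 = x by rewrite r1.
have [r2 m2 o2] := set_flagP hw flag_expr s10' r14 s110 ln xn o1k.
rewrite eval_flag_expr // r1 // s11 r1 // s10 r12 in m2.
set s2 := sem w (set_flag 14 10 _) s1 in r2 m2 o2 *; clearbody s2.
set b := nat_of_bool _ in m2.
have s20 : reg s2 0 = n by rewrite r2.
have s26 : reg s2 6 = v by rewrite r2 r1.
have s210 : reg s2 10 = x by rewrite r2.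
have [r3 m3 o3] := set_flagP hw (Const 0) s20 s26 s210 vn xn o2.
rewrite eval_const // in m3.
set s3 := sem w _ s2 in r3 m3 o3 *; clearbody s3.
have f3 t a' b' c' : a' < n -> b' < n -> c' < n -> t != 7 ->
    cell (mem s3) t a' b' c' = cell (mem s1) t a' b' c'.
  by move=> a'n b'n c'n t7; rewrite m3 m2 !cell_upd // (negPf t7).
have flagE v' x' : v' < n -> x' < n -> cell (mem s3) 7 v' x' 0 =
    if (v' == v) && (x' == x) then 0 else
    if (v' == l) && (x' == x) then b else cell (mem s) 7 v' x' 0.
  by move=> v'n x'n; rewrite m3 m2 !cell_upd // !eqxx !andbT f1.
split.
- split=> //.
  + move=> p' x' p'n x'n.
    have [/andP[/eqP e1 /eqP e2]|ne'] := boolP ((p' == p) && (x' == x)).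
      by rewrite e1 e2; apply: array_at_frame a1 => // t c' t3 c'n; rewrite f3 //; lia.
    apply: array_at_frame (wa p' x' p'n x'n) => // t c' t3 c'n.
    by rewrite f3 ?f1 // ?/in_array ?(negPf ne') ?andbF //; lia.
  + move=> v' x' p' v'n x'n p'n; rewrite f3 //.
    have [[-> -> ->]|ne] : [/\ v' = v, x' = x & p' = p] \/ ~ [/\ v' = v, x' = x & p' = p].
      case: (v' =P v) (x' =P x) (p' =P p) => [-> []//|ne]; last by right=> -[].
        by move=> -> []; [left | right=> -[]].
      by move=> ? _; right=> -[].
    * by rewrite posE // !eqxx; split=> // -[_ []].
    * rewrite -wm //; split=> [h|[h _]]; first by split=> //; apply: pos_le h.
      rewrite posE //; case: andP => [[/eqP e1 /eqP e2]|//].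
      case: eqP => e3; first by case: ne.
      by case: eqP.
  + move=> v' x' p1 p2 v'n x'n p1n p2n; rewrite !f3 // => /pos_le h1 /pos_le h2.
    by apply: wu (h1 _ _ _) (h2 _ _ _).
  + move=> v' x' p' v'n x'n p'n; rewrite f3 // => h; rewrite flagE //.
    have h' := pos_le _ _ _ v'n x'n p'n h.
    have [/andP[/eqP e1 /eqP e2]|ne] := boolP ((v' == v) && (x' == x)).
      rewrite e1 e2 in h h'; move: h; rewrite posE //.
      by rewrite (wu _ _ _ _ vn xn p'n pn h' q0) !eqxx.
    move: h; rewrite posE //.
    have [/andP[/eqP e1 /eqP e2]|ne2] := boolP ((v' == l) && (x' == x)).
      (* Uniqueness turns [p'] into [p], the value for which the flag of [l] has just been
         computed. *)
      rewrite e1 e2 in h' ne *; rewrite (wu _ _ _ _ ln xn p'n pn h' pl) !eqxx /=.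
      by move: ne; rewrite eqxx andbT => /negPf ->.
    case: andP => [[/eqP e1 /eqP e2]|_ _]; last exact: wf.
    move: ne ne2; rewrite e2 eqxx !andbT => /negPf -> /negPf ->; rewrite -e2 => _.
    exact: wf.
  + move=> v' x' v'n x'n; rewrite flagE //.
    have [//|ne] := boolP ((v' == v) && (x' == x)).
    have [/andP[/eqP e1 /eqP e2]|ne2] := boolP ((v' == l) && (x' == x)).
      move=> _; exists p => //; rewrite f3 // e1 e2 posE // !eqxx /=.
      by move: ne; rewrite e1 e2 eqxx andbT => /negPf ->.
    case/wv=> // p' p'n h; exists p' => //; rewrite f3 // posE //.
    case: andP => [[/eqP e1 /eqP e2]|//].
    by move: ne ne2; rewrite e2 eqxx !andbT => /negPf -> /negPf ->; rewrite -e2.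
- by move=> r r12'; rewrite r3 r2 r1.
- move=> t a' b' c' a'n b'n c'n nt t7; rewrite f3 // f1 // /in_array.
  by rewrite (negPf nt).
Qed.

Definition keep s s' := (forall r, r < 9 -> reg s' r = reg s r) /\ frame s s'.

(** The body respects [frame], so [elem] and [cnt], read in the initial state, remain valid
    throughout; [P j] is the relation reached after [j] neighbours. *)
Lemma for_bucketP body (P : nat -> triple_pred) s v i :
  let elem := cell (mem s) 5 v i in let cnt := cell (mem s) 6 v i 0 in
  loop_free body -> reg s 0 = n -> reg s 6 = v -> reg s 8 = i -> v < n -> i < n ->
  array_at (mem s) 3 v i ->
  (forall j s', j < cnt -> reg s' 0 = n -> reg s' 6 = v -> reg s' 10 = elem j ->
     reg s' 11 = elem 0 -> witness_ok (P j) s' ->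
     effect (P j.+1) s' (sem w body s')) ->
  witness_ok (P 0) s ->
  run w (for_bucket body) s (60 + (60 + ccost body) * cnt)
    (fun s' => witness_ok (P cnt) s' /\ keep s s').
Proof.
move=> elem cnt lf s0 s6 s8 vn i_n ok stepP P0.
have n0 : 0 < n by lia.
have z s' : eval w s' (Const 0) = 0 by rewrite eval_const.
have o s' : eval w s' (Const 1) = 1 by rewrite eval_const //; lia.
have cn : cnt <= n := array_ok_le ok.
pose I j s' := [/\ witness_ok (P j) s', keep s s' & reg s' 9 = j].
have guardE j s' : I j s' ->
    eval w s' (Bin OpLt (Reg 9) (Read (addr_expr 6 (Reg 6) (Reg 8) (Const 0)))) =
    (j < cnt).
  move=> [_ [kr kf] r9]; rewrite (eval_bool hw _ _ _).1.
  by rewrite (@eval_cell n w hw s' 6 _ _ _ v i 0) /= ?mod0n ?r9 ?kr ?kf.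
have kI : I 0 (set_reg s 9 0).
  split=> //; first exact: witness_ok_frame P0.
  by split=> // r rlt; rewrite /= /upd; case: eqP => //; lia.
set G := Bin OpLt _ _ in guardE; set T := ccost body.
apply: (@run_impl n w _ _ (2 + ((ecost G + (40 + T)).+1 * cnt + (ecost G).+1)) _ (I cnt)).
- by rewrite /=; nia.
- by move=> s' [].
apply: run_seq (_ : forall s1, s1 = set_reg s 9 0 -> _).
  by have := run_sem w s (isT : loop_free (Assign 9 (Const 0))); rewrite /= mod0n; apply: run_impl.
move=> _ ->; apply: run_while => //.
- move=> j s' jc Ij; split; first by rewrite (guardE j) // jc.
  case: Ij => ok' [kr kf] r9.
  have [ejn pj] := ok.2 j jc; have [e0n p0] := ok.2 0 (leq_ltn_trans (leq0n j) jc).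
  rewrite -/elem in ejn pj e0n p0.
  have jn : j < n by lia.
  set c := Seq _ _; apply: (@run_impl n w _ _ (ccost c) _ (eq (sem w c s'))).
  + by rewrite /= -/T; lia.
  + have e0 : reg s' 0 = n by rewrite kr.
    have e6 : reg s' 6 = v by rewrite kr.
    have e8 : reg s' 8 = i by rewrite kr.
    move=> _ <-; rewrite /c !sem_seq {c}.
    rewrite (@sem_load n w hw s' _ _ _ _ _ v i j) //.
    rewrite kf // -/elem -/(elem j); set s1 := set_reg s' 10 _.
    rewrite (@sem_load n w hw s1 _ _ _ _ _ v i 0) //.
    rewrite kf // -/elem -/(elem 0); set s2 := set_reg s1 11 _.
    have ok2 : witness_ok (P j) s2 by apply: witness_ok_frame ok'.
    have := stepP j s2 jc e0 e6 erefl erefl ok2.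
    set s3 := sem w body s2 => -[ok3 r3 f3].
    have r39 : reg s3 9 = j by rewrite r3.
    have E : eval w s3 (Bin OpAdd (Reg 9) (Const 1)) = j.+1.
      by rewrite eval_add ?o /= ?r39 ?addn1 //; apply: (small_word hw); nia.
    rewrite (@sem_assign n w s3 9 _ j.+1 E); split.
    * exact: witness_ok_frame ok3.
    * split=> [r r9'|t a b c an bn cn' nt t7].
        rewrite /= /upd; case: eqP => [e|_]; first by lia.
        rewrite r3; last by lia.
        by rewrite -kr // /= /upd; do 2!(case: eqP => [e|_]; first by lia).
      by rewrite f3 // -kf.
    * by [].
  + by apply: run_sem; rewrite /= lf.
- by move=> s' Ij; rewrite (guardE _ _ Ij) ltnn.
Qed.

End ArcUpdate.

(** * Updates of single arcs *)

Section Buckets.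
Context (n q : nat).
Implicit Types (s : state n) (D : rel nat) (m : nat -> nat).
Local Notation cell := (mem_cell n).
Local Notation array_at := (array_at n).

(** [D] is a relation on arcs rather than a graph, since it is not symmetric between the two halves
    of an edge update. *)
Definition arcs_ok D m :=
  (forall v i, v < n -> i < n -> array_at m 3 v i) /\
  (forall v i x, v < n -> i < n -> x < n ->
     0 < cell m 4 v i x <-> D v x /\ i = x %/ q).

Definition partner_arcs D m : triple_pred :=
  fun v x p => D v x /\ p = cell m 5 v (x %/ q) 0.

Definition spanner_inv D s :=
  [/\ reg s 0 = n, reg s 4 = q, arcs_ok D (mem s) &
      witness_ok (partner_arcs D (mem s)) s].

Definition bucket_degree D v i :=
  count (fun x => D v x && (x %/ q == i)) (iota 0 n).

Definition set_arc D v u b : rel nat :=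
  fun v' x => if (v' == v) && (x == u) then b else D v' x.

Lemma arcs_ok_frame D m m' :
  (forall t a b c, a < n -> b < n -> c < n -> 3 < t <= 6 ->
     cell m' t a b c = cell m t a b c) ->
  arcs_ok D m -> arcs_ok D m'.
Proof.
move=> E [A M]; split=> [v i vn i_n|v i x vn i_n xn].
  apply: array_at_frame (A v i vn i_n) => [|t c t3 cn]; first by lia.
  by rewrite E //; lia.
by rewrite E //; exact: M.
Qed.

Lemma size_le_bucket_degree D m v i : v < n -> i < n -> arcs_ok D m ->
  cell m 6 v i 0 <= bucket_degree D v i.
Proof.
move=> vn i_n [A M]; rewrite /bucket_degree -size_filter.
have ok := A v i vn i_n.
apply: (@leq_inj_size _ (cell m 5 v i)) => [j k|j jc]; first exact: array_ok_inj ok.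
have [ejn pj] : cell m 5 v i j < n /\ cell m 4 v i (cell m 5 v i j) = j.+1.
  exact: ok.2 j jc.
have /(M v i _ vn i_n ejn)[Dv ie] : 0 < cell m 4 v i (cell m 5 v i j) by rewrite pj.
by rewrite mem_filter mem_iota Dv -ie eqxx.
Qed.

Lemma effect_iff (P P' : triple_pred) s s' :
  (forall v x p, v < n -> x < n -> p < n -> P v x p <-> P' v x p) ->
  effect P s s' -> effect P' s s'.
Proof. by move=> PP' [/(witness_ok_iff PP') ? ? ?]. Qed.

(** The pass empties the part of the relation with tail [v] and heads in bucket [i], the only part
    that depends on the partner of [v] there. *)
Lemma run_witness_remove w D s v i : 8 * n.+1 ^ 3 <= 2 ^ w ->
  spanner_inv D s -> reg s 6 = v -> reg s 8 = i -> v < n -> i < n ->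
  run w (for_bucket witness_remove) s
    (60 + (60 + ccost witness_remove) * bucket_degree D v i)
    (fun s' => keep s s' /\
       witness_ok (fun v' x p => partner_arcs D (mem s) v' x p /\
                     ~ (v' = v /\ x %/ q = i)) s').
Proof.
move=> hw [s0 s4 arcs wok] s6 s8 vn i_n; case: (arcs) => A M.
have ok := A v i vn i_n; have cle := size_le_bucket_degree vn i_n arcs.
set elem := cell (mem s) 5 v i; set c := cell (mem s) 6 v i 0 in cle.
(* Positions start at 1 and end at [c]: [P 0] excludes no arc, and [P c] excludes all arcs from [v]
   into the bucket. *)
pose P j : triple_pred := fun v' x p => partner_arcs D (mem s) v' x p /\
  ~ [/\ v' = v, x %/ q = i & cell (mem s) 4 v i x <= j].
apply: (@run_impl n w _ _ (60 + (60 + ccost witness_remove) * c) _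
  (fun s' => witness_ok (P c) s' /\ keep s s')).
- by rewrite leq_add2l leq_mul2l cle orbT.
- move=> s' [h k]; split=> //; apply: witness_ok_iff h => v' x p v'n xn pn.
  split=> -[pa nP]; split=> //; last by case=> e1 e2 _; apply: nP.
  case=> e1 e2; apply: nP; split=> //.
  have [->//|px] := posnP (cell (mem s) 4 v i x).
  by have [] := ok.1 x xn px.
apply: for_bucketP => //.
- move=> j s' jc s0' s6' s10' s11' ok'.
  have [ejn pj] : elem j < n /\ cell (mem s) 4 v i (elem j) = j.+1 := ok.2 j jc.
  have [e0n _] := ok.2 0 (leq_ltn_trans (leq0n j) jc).
  have /(M v i _ vn i_n ejn)[Dv ie] : 0 < cell (mem s) 4 v i (elem j) by rewrite pj.
  have Pj : P j v (elem j) (elem 0).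
    by split; [split; rewrite // -ie | case=> _ _; rewrite pj ltnn].
  apply: effect_iff (witness_removeP hw s0' s6' s10' s11' vn ejn e0n ok' Pj).
  move=> v' x p v'n xn pn; split=> [[[pa nP] ne]|[pa nP]].
    split=> // -[e1 e2 le]; apply: nP; split=> //.
    rewrite leqNgt; apply/negP => lt.
    have pe : cell (mem s) 4 v i x = j.+1 by lia.
    have px : 0 < cell (mem s) 4 v i x by rewrite pe.
    have [_ ex] := ok.1 x xn px.
    have ex' : x = elem j by rewrite -ex [X in X.-1]pe.
    by apply: ne; split=> //; case: pa => _ ->; rewrite e1 e2.
  split; first by split=> // -[e1 e2 le]; apply: nP; split=> //; lia.
  by case=> e1 e2 _; apply: nP; split; rewrite ?e1 ?e2 // pj.
- apply: witness_ok_iff wok => v' x p v'n xn pn; split=> [pa|[] //].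
  split=> // -[e1 e2 le]; case: pa => Dx _.
  have /(M v i x vn i_n xn) : D v x /\ i = x %/ q by rewrite -e1.
  by lia.
Qed.

Lemma run_witness_add w D s v i : 8 * n.+1 ^ 3 <= 2 ^ w ->
  reg s 0 = n -> arcs_ok D (mem s) ->
  witness_ok (fun v' x p => partner_arcs D (mem s) v' x p /\
                     ~ (v' = v /\ x %/ q = i)) s ->
  reg s 6 = v -> reg s 8 = i -> v < n -> i < n ->
  run w (for_bucket witness_add) s
    (60 + (60 + ccost witness_add) * bucket_degree D v i)
    (fun s' => keep s s' /\ witness_ok (partner_arcs D (mem s)) s').
Proof.
move=> hw s0 arcs wok s6 s8 vn i_n; case: (arcs) => A M.
have ok := A v i vn i_n; have cle := size_le_bucket_degree vn i_n arcs.
set elem := cell (mem s) 5 v i; set c := cell (mem s) 6 v i 0 in cle.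
(* Dually, [P 0] admits no arc from [v] into the bucket, and [P c] admits all of them. *)
pose P j : triple_pred := fun v' x p => partner_arcs D (mem s) v' x p /\
  (v' = v -> x %/ q = i -> cell (mem s) 4 v i x <= j).
apply: (@run_impl n w _ _ (60 + (60 + ccost witness_add) * c) _
  (fun s' => witness_ok (P c) s' /\ keep s s')).
- by rewrite leq_add2l leq_mul2l cle orbT.
- move=> s' [h k]; split=> //; apply: witness_ok_iff h => v' x p v'n xn pn.
  split=> [[]//|pa]; split=> // e1 e2.
  have [->//|px] := posnP (cell (mem s) 4 v i x).
  by have [] := ok.1 x xn px.
apply: for_bucketP => //.
- move=> j s' jc s0' s6' s10' s11' ok'.
  have [ejn pj] : elem j < n /\ cell (mem s) 4 v i (elem j) = j.+1 := ok.2 j jc.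
  have [e0n _] := ok.2 0 (leq_ltn_trans (leq0n j) jc).
  have /(M v i _ vn i_n ejn)[Dv ie] : 0 < cell (mem s) 4 v i (elem j) by rewrite pj.
  have nP p' : p' < n -> ~ P j v (elem j) p'.
    by move=> _ [_ /(_ erefl (esym ie))]; rewrite pj ltnn.
  apply: effect_iff (witness_addP hw s0' s6' s10' s11' vn ejn e0n ok' nP).
  move=> v' x p v'n xn pn; split=> [[[pa le]|[-> -> ->]]|[pa le]].
  + by split=> // e1 e2; have := le e1 e2; lia.
  + by split; [split; rewrite // -ie | rewrite pj].
  + have [[e1 e2 pe]|ne] : [/\ v' = v, x %/ q = i & cell (mem s) 4 v i x = j.+1] \/
        (v' = v -> x %/ q = i -> cell (mem s) 4 v i x <= j).
      have [e1|] := v' =P v; last by right.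
      have [e2|] := x %/ q =P i; last by right.
      by have := le e1 e2; rewrite leq_eqVlt => /orP[/eqP|]; [left | right].
    * right; have px : 0 < cell (mem s) 4 v i x by rewrite pe.
      have [_ ex] := ok.1 x xn px.
      by split=> //; [rewrite -ex [X in X.-1]pe | case: pa => _ ->; rewrite e1 e2].
    * by left.
- apply: witness_ok_iff wok => v' x p v'n xn pn; split=> -[pa h].
    by split=> // e1 e2; case: h.
  split=> // -[e1 e2]; case: pa => Dx _.
  have /(M v i x vn i_n xn) : D v x /\ i = x %/ q by rewrite -e1.
  by have := h e1 e2; lia.
Qed.

Lemma run_array_toggle w D s v u : 8 * n.+1 ^ 3 <= 2 ^ w ->
  let i := u %/ q in let b := reg s 1 != 0 in
  reg s 0 = n -> reg s 6 = v -> reg s 8 = i -> reg s 7 = u -> v < n -> u < n ->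
  arcs_ok D (mem s) -> D v u = ~~ b ->
  run w (If (Reg 1) (array_add 3 6 8 7) (array_remove 3 6 8 7)) s 300
    (fun s' => [/\ arcs_ok (set_arc D v u b) (mem s'),
       forall r, r < 12 -> reg s' r = reg s r, out s' = out s &
       forall t a' b' c', a' < n -> b' < n -> c' < n ->
        ~~ in_array 3 v i t a' b' -> cell (mem s') t a' b' c' = cell (mem s) t a' b' c']).
Proof.
move=> hw i b s0 s6 s8 s7 vn un [A M] Dvu.
have i_n : i < n by apply: leq_ltn_trans un; exact: leq_div.
have ok := A v i vn i_n.
have arcsP (m' : nat -> nat) : array_at m' 3 v i ->
    (forall y, y < n -> (0 < cell m' 4 v i y) =
       if y == u then b else 0 < cell (mem s) 4 v i y) ->
    (forall t a' b' c', a' < n -> b' < n -> c' < n ->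
        ~~ in_array 3 v i t a' b' -> cell m' t a' b' c' = cell (mem s) t a' b' c') ->
    arcs_ok (set_arc D v u b) m'.
  move=> A' pos' f'; split=> [v' i' v'n i'n|v' i' x v'n i'n xn].
    have [/andP[/eqP -> /eqP ->//]|ne] := boolP ((v' == v) && (i' == i)).
    apply: array_at_frame (A v' i' v'n i'n) => [|t c' t3 c'n]; first by lia.
    by rewrite f' // /in_array (negPf ne) andbF.
  have [/andP[/eqP -> /eqP ->]|ne] := boolP ((v' == v) && (i' == i)).
    rewrite pos' // /set_arc eqxx /=; case: eqP => [->|_]; last exact: M.
    by split=> [|[]].
  rewrite f' // ?/in_array ?(negPf ne) ?andbF // M //.
  rewrite /set_arc; case: andP => [[/eqP e1 /eqP e2]|//].
  by move: ne; rewrite e1 e2 eqxx /= => /eqP ne; split=> -[_ /ne].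
apply: (@run_impl n w _ _ (ecost (Reg 1) + 200).+1 _ _ _ _ (fun _ h => h)) => //.
apply: run_if => r1.
  have ins : b by [].
  have pu : cell (mem s) 4 v i u = 0.
    apply/eqP; rewrite -leqn0 leqNgt; apply/negP => /(M v i u vn i_n un)[].
    by rewrite Dvu ins.
  apply: run_impl (run_sem w s (_ : loop_free (array_add 3 6 8 7))) => // _ <-.
  have := @array_addP n w hw 3 6 8 7 s v i u isT isT isT isT s0 s6 s8 s7 vn i_n un ok pu.
  move=> [A' pos' [_ r'] o' f']; split=> //; apply: arcsP => // y yn.
  by rewrite pos' //; case: eqP; rewrite ?ins.
have nins : b = false by rewrite /b; apply/negbF/eqP.
have pu : 0 < cell (mem s) 4 v i u by apply/M => //; rewrite Dvu nins.
apply: run_impl (run_sem w s (_ : loop_free (array_remove 3 6 8 7))) => // _ <-.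
have := @array_removeP n w hw 3 6 8 7 s v i u isT isT isT isT s0 s6 s8 s7 vn i_n un ok pu.
move=> [l [[ln _ _ r'] A' [pl pos'] o' f']]; split=> //; apply: arcsP => // y yn.
rewrite pos' //; case: eqP => [_|_]; first by rewrite nins.
by case: eqP => [->|//]; rewrite pu pl.
Qed.

(** The first pass runs over the old neighbours in the bucket and the second over the new ones,
    whence the two bucket degrees. The initialization, which still reads the matrix, uses the last
    clause. *)
Lemma run_arc_update w D s v u : 8 * n.+1 ^ 3 <= 2 ^ w ->
  let b := reg s 1 != 0 in let D' := set_arc D v u b in
  spanner_inv D s -> reg s 6 = v -> reg s 7 = u -> v < n -> u < n -> D v u = ~~ b ->
  run w arc_update s
    (1000 + 1000 * (bucket_degree D v (u %/ q) + bucket_degree D' v (u %/ q)))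
    (fun s' => [/\ spanner_inv D' s', forall r, r < 8 -> reg s' r = reg s r &
       forall a, a < n * n -> mem s' a = mem s a]).
Proof.
move=> hw b D' [s0 s4 arcs wok] s6 s7 vn un Dvu; set i := u %/ q.
have n0 : 0 < n by lia.
have i_n : i < n by apply: leq_ltn_trans un; exact: leq_div.
pose s1 := set_reg s 8 i.
apply: (@run_impl n w _ _ (4 + ((60 + (60 + ccost witness_remove) * bucket_degree D v i) +
  (300 + (60 + (60 + ccost witness_add) * bucket_degree D' v i)))) _ _ _ _ (fun _ h => h)).
  by rewrite /=; lia.
apply: run_seq (_ : forall s', s' = s1 -> _).
  apply: run_impl (run_sem w s (_ : loop_free (Assign 8 _))) => // _ <-.
  rewrite /= /binop_sem s7 s4 modn_small //.
  by apply: (small_word hw); rewrite -/i; nia.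
move=> _ ->.
have inv1 : spanner_inv D s1 by split=> //; exact: witness_ok_frame wok.
apply: run_seq (run_witness_remove hw inv1 s6 erefl vn i_n) _ => s2 [[k2 f2] wok2].
have arcs2 : arcs_ok D (mem s2).
  by apply: arcs_ok_frame arcs => t a b' c' an bn cn t3; rewrite f2 //; lia.
have b2 : (reg s2 1 != 0) = b by rewrite k2.
apply: run_seq (_ : forall s3, _ -> _).
  apply: run_array_toggle (hw) _ _ _ _ vn un arcs2 _; rewrite ?k2 //.
rewrite b2 -/D' -/i => s3 [arcs3 k3 o3 f3].
have wok3 : witness_ok (fun v' x p => partner_arcs D' (mem s3) v' x p /\
    ~ (v' = v /\ x %/ q = i)) s3.
  have f32 t a b' c' : a < n -> b' < n -> c' < n -> (t <= 3) || (t == 7) ->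
      cell (mem s3) t a b' c' = cell (mem s2) t a b' c'.
    by move=> an bn cn t3; rewrite f3 // /in_array; lia.
  apply: (witness_ok_frame f32 o3); apply: witness_ok_iff wok2 => v' x p v'n xn pn.
  have xq : x %/ q < n by apply: leq_ltn_trans xn; exact: leq_div.
  (* Changing the array with key [(v, i)] can change only the partner of [v] in bucket [i], and the
     triples that mention this partner have been removed. *)
  suff E : ~ (v' = v /\ x %/ q = i) ->
      partner_arcs D (mem s) v' x p <-> partner_arcs D' (mem s3) v' x p.
    by split=> -[h ne]; split=> //; apply/E.
  move=> ne; have nin : ~~ in_array 3 v i 5 v' (x %/ q).
    by apply/negP => /and3P[_ /eqP e1 /eqP e2]; apply: ne.
  rewrite /partner_arcs f3 // f2 //.
  suff -> : D' v' x = D v' x by [].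
  rewrite /D' /set_arc; case: andP => // -[/eqP e1 /eqP e2].
  by case: ne; rewrite e1 e2.
have k3' r : r < 9 -> reg s3 r = reg s1 r by move=> rlt; rewrite k3 ?k2 //; lia.
have [s30 s36 s38] : [/\ reg s3 0 = n, reg s3 6 = v & reg s3 8 = i] by rewrite !k3'.
apply: run_impl (run_witness_add hw s30 arcs3 wok3 s36 s38 vn i_n) => // s' [[k' f'] wok'].
split.
- split; rewrite ?k' ?k3' //.
    by apply: arcs_ok_frame arcs3 => t a b' c' an bn cn t3; rewrite f' //; lia.
  apply: witness_ok_iff wok' => v' x p v'n xn pn.
  have xq : x %/ q < n by apply: leq_ltn_trans xn; exact: leq_div.
  by rewrite /partner_arcs f' //; lia.
- move=> r r8; rewrite k' ?k3' /=; try lia.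
  by rewrite /upd; case: eqP => // e; lia.
(* The input matrix consists of cells of region 0, to which all three frame conditions apply. *)
- move=> a an; have aE : addr n 0 0 (a %/ n) (a %% n) = a by rewrite /addr -divn_eq.
  have [dn rn] : a %/ n < n /\ a %% n < n by rewrite ltn_divLR // ltn_mod.
  have := f' 0 0 _ _ n0 dn rn isT isT; rewrite f3 // f2 //.
  by rewrite /mem_cell aE.
Qed.

End Buckets.

(** * Stretch and size of the output graph *)

Section Graphs.
Context (n q : nat).
Implicit Types (s : state n) (D : rel nat) (E H : edge_set n).
Local Notation cell := (mem_cell n).
Local Notation array_at := (array_at n).
Local Notation spanner_inv := (@spanner_inv n q).
Local Notation partner_arcs := (partner_arcs n q).

Definition graph_arcs E : rel nat := fun v x => word_edge n v x \in E.

Lemma word_edge_ord (u v : 'I_n) : word_edge n u v = u |: [set v].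
Proof. by apply/setP => x; rewrite !inE. Qed.

Lemma graph_arcs_ord E (u v : 'I_n) : graph_arcs E u v = adj E u v.
Proof. by rewrite /graph_arcs word_edge_ord. Qed.

Lemma graph_arcsC E v x : graph_arcs E v x = graph_arcs E x v.
Proof. by rewrite /graph_arcs word_edgeC. Qed.

Lemma simple_adj_neq E u v : simple_graph E -> adj E u v -> u != v.
Proof.
move=> /forall_inP h /h; apply: contraTneq => ->.
by rewrite setUid cards1.
Qed.

Lemma simple_apply_update E up :
  simple_graph E -> valid_update E up -> simple_graph (apply_update E up).
Proof.
move=> /forall_inP h; case: up => u v /= val; apply/forall_inP => e; rewrite !inE.
  by case/orP => [/h //|/eqP ->]; rewrite cards2; case/andP: val => ->.
by case/andP => _ /h.
Qed.

Lemma spanner_inv_ext D D' s : (forall v x, v < n -> x < n -> D v x = D' v x) ->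
  spanner_inv D s -> spanner_inv D' s.
Proof.
move=> DD' [s0 s4 [A M] wok]; split=> //.
  by split=> // v i x vn i_n xn; rewrite -DD' //; exact: M.
by apply: witness_ok_iff wok => v x p vn xn pn; rewrite /partner_arcs DD'.
Qed.

Lemma spanner_inv_reg D s s' : reg s' 0 = reg s 0 -> reg s' 4 = reg s 4 ->
  mem s' = mem s -> out s' = out s -> spanner_inv D s -> spanner_inv D s'.
Proof.
move=> r0 r4 m' o' [s0 s4 arcs wok]; split; rewrite ?r0 ?r4 ?m' //.
by apply: witness_ok_frame wok => // t a b c *; rewrite m'.
Qed.

Lemma bucket_degree_ext D D' v i : (forall x, x < n -> D v x = D' v x) ->
  bucket_degree n q D v i = bucket_degree n q D' v i.
Proof.
by move=> DD'; apply: eq_in_count => x; rewrite mem_iota => xn; rewrite DD'.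
Qed.

(** The residue modulo [q] is injective on a bucket. *)
Lemma bucket_degree_le_size D v i : 0 < q -> bucket_degree n q D v i <= q.
Proof.
move=> q0; rewrite /bucket_degree -size_filter -[X in _ <= X](size_iota 0 q).
set l := seq.filter _ _; rewrite -(size_map (modn^~ q) l); apply: uniq_leq_size.
  rewrite map_inj_in_uniq ?filter_uniq ?iota_uniq // => x y.
  rewrite !mem_filter => /andP[/andP[_ /eqP ex] _] /andP[/andP[_ /eqP ey] _] e.
  by rewrite (divn_eq x q) (divn_eq y q) ex ey e.
by move=> _ /mapP[x _ ->]; rewrite mem_iota ltn_mod.
Qed.

Lemma bucket_degree_le_degree E (v : 'I_n) i :
  bucket_degree n q (graph_arcs E) v i <= degree E v.
Proof.
rewrite /bucket_degree -val_enum_ord count_map /degree cardE enumT.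
rewrite /enum_mem size_filter -enumT; apply: sub_count => x /=.
by case/andP; rewrite graph_arcs_ord.
Qed.

Lemma flag_pos E s v x p : spanner_inv (graph_arcs E) s ->
  v < n -> x < n -> p < n ->
  0 < cell (mem s) 1 p x v -> (p == x) || (cell (mem s) 1 p x v == 1) ->
  word_edge n v x \in out s.
Proof.
move=> [_ _ _ wok] vn xn pn h1 h2; apply/(witness_out wok); exists v, x; split=> //.
by rewrite (witness_flag wok vn xn pn h1) h2.
Qed.

(** A partner lies in the bucket that it serves, so it is also the partner of [v] for the head [p]
    itself; this is what puts the edge from [v] to [p] into the output. *)
Lemma partnerP E s v x : spanner_inv (graph_arcs E) s -> v < n -> x < n ->
  graph_arcs E v x -> exists p, [/\ p < n, p %/ q = x %/ q,
    partner_arcs (graph_arcs E) (mem s) v x p &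
    partner_arcs (graph_arcs E) (mem s) v p p].
Proof.
move=> [_ _ [A M] _] vn xn Dvx.
have xq : x %/ q < n by apply: leq_ltn_trans xn; exact: leq_div.
have px : 0 < cell (mem s) 4 v (x %/ q) x by apply/M.
have ok := A v _ vn xq; have [le _] := ok.1 x xn px.
have c0 : 0 < cell (mem s) 6 v (x %/ q) 0 by apply: leq_trans le.
have [pn p1] : cell (mem s) 5 v (x %/ q) 0 < n /\
    cell (mem s) 4 v (x %/ q) (cell (mem s) 5 v (x %/ q) 0) = 1 by exact: ok.2 0 c0.
set p := cell _ 5 _ _ _ in pn p1.
have /(M v _ p vn xq pn)[Dvp pq] : 0 < cell (mem s) 4 v (x %/ q) p by rewrite p1.
by exists p; split=> //; split=> //; rewrite -pq.
Qed.

Lemma out_sub E s : spanner_inv (graph_arcs E) s -> out s \subset E.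
Proof.
move=> [_ _ _ wok]; apply/subsetP => e /(witness_out wok)[v [x [vn xn h ->]]].
have [p pn hp] := witness_unflag wok vn xn h.
by have [] := (witness_mem wok vn xn pn).1 hp.
Qed.

Lemma three_path E s (u v : 'I_n) : spanner_inv (graph_arcs E) s -> adj E u v ->
  exists p z, [/\ adj (out s) u p, adj (out s) p z & adj (out s) z v].
Proof.
move=> inv; rewrite -graph_arcs_ord => Duv; case: (inv) => _ _ _ wok.
have partner_edge x p : x < n -> p < n ->
    partner_arcs (graph_arcs E) (mem s) x p p -> word_edge n x p \in out s.
  move=> xn pn /(witness_mem wok xn pn pn) h.
  by apply: (flag_pos inv xn pn pn h); rewrite eqxx.
have [p [pn pq Puv Pup]] := partnerP inv (ltn_ord u) (ltn_ord v) Duv.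
have wuv := (witness_mem wok (ltn_ord u) (ltn_ord v) pn).2 Puv.
have ok := witness_array wok pn (ltn_ord v).
have [le _] := ok.1 u (ltn_ord u) wuv.
have [zn z1] : cell (mem s) 2 p v 0 < n /\
    cell (mem s) 1 p v (cell (mem s) 2 p v 0) = 1.
  by apply: ok.2 0 _; apply: leq_trans le.
set z := cell _ 2 _ _ _ in zn z1.
have wzv : 0 < cell (mem s) 1 p v z by rewrite z1.
have Pzv := (witness_mem wok zn (ltn_ord v) pn).1 wzv.
(* Membership of [z] in [W p v] means that the partner of [z] in the bucket of [v] is [p], the same
   as that of [u]. *)
have [p' [p'n _ [_ p'E] Pzp']] := partnerP inv zn (ltn_ord v) Pzv.1.
have pp' : p' = p by rewrite p'E; case: Pzv.
rewrite pp' in Pzp'.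
exists (Ordinal pn), (Ordinal zn); rewrite -!graph_arcs_ord; split.
- exact: partner_edge Pup.
- by rewrite graph_arcsC; exact: partner_edge Pzp'.
- by apply: (flag_pos inv zn (ltn_ord v) pn wzv); rewrite z1 orbT.
Qed.

Lemma stretch_path E s (u : 'I_n) l : spanner_inv (graph_arcs E) s ->
  path (adj E) u l -> exists l', [/\ path (adj (out s)) u l', last u l' = last u l &
    size l' = 3 * size l].
Proof.
move=> inv; elim: l u => [|v l IHl] u /=; first by exists [::].
case/andP => uv /IHl[l' [pl' ll' sl']].
have [p [z [h1 h2 h3]]] := three_path inv uv.
exists [:: p, z, v & l']; split=> //=; first by rewrite h1 h2 h3.
by rewrite sl'; lia.
Qed.

(** Partner edges are indexed by a vertex and a bucket. The other edges are indexed by [p] and the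
    offset of [x] within the bucket of [p], since both lie in the same bucket. Junk values of [f]
    and [g] do no harm to an upper bound. *)
Lemma card_out_le E s : n <= q * q -> spanner_inv (graph_arcs E) s ->
  #|out s| <= 2 * (n * q).
Proof.
move=> nq inv; case: (inv) => _ _ _ wok.
pose f (y : 'I_n * 'I_q) := word_edge n y.1 (cell (mem s) 5 y.1 y.2 0).
pose g (y : 'I_n * 'I_q) := let x := y.1 %/ q * q + y.2 in
  word_edge n (cell (mem s) 2 y.1 x 0) x.
have sub : out s \subset (f @: setT) :|: (g @: setT).
  apply/subsetP => e /(witness_out wok)[v [x [vn xn h ->]]].
  have q0 : 0 < q by rewrite lt0n; apply/eqP => e0; move: nq; rewrite e0; lia.
  have [p pn hp] := witness_unflag wok vn xn h.
  have xq : x %/ q < q by rewrite ltn_divLR //; apply: leq_trans nq.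
  have Pvx := (witness_mem wok vn xn pn).1 hp.
  move: h; rewrite (witness_flag wok vn xn pn hp) inE.
  have [px _|_] := eqVneq p x.
    apply/orP; left; apply/imsetP; exists (Ordinal vn, Ordinal xq) => //.
    by rewrite /f /= -Pvx.2 px.
  case: eqP => //= p1 _; apply/orP; right; apply/imsetP.
  have xm : x %% q < q by rewrite ltn_mod.
  exists (Ordinal pn, Ordinal xm) => //; rewrite /g /=.
  have [p' [_ p'q [_ p'E] _]] := partnerP inv vn xn Pvx.1.
  have pq : p %/ q = x %/ q by rewrite -p'q p'E; case: Pvx => _ ->.
  rewrite pq -divn_eq.
  have [_ ev] := (witness_array wok pn xn).1 v vn hp.
  by rewrite -[in LHS]ev /= p1.
have card_im (h : 'I_n * 'I_q -> {set 'I_n}) : #|h @: setT| <= n * q.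
  by apply: leq_trans (leq_imset_card _ _) _; rewrite cardsT card_prod !card_ord.
apply: leq_trans (subset_leq_card sub) _; rewrite mul2n -addnn.
exact: leq_trans (leq_card_setU _ _) (leq_add (card_im f) (card_im g)).
Qed.

End Graphs.

(** * From paths to distances *)

Section Stretch.
Local Open Scope ring_scope.
Local Open Scope ereal_scope.

Lemma spanner_of_inv (R : realType) n q (E : edge_set n) s :
  spanner_inv q (graph_arcs E) s -> spanner (3 : R) E (out s).
Proof.
move=> inv; have HE := out_sub inv; split=> // u v; split.
  apply: ereal_inf_le_tmp => d /= [p [pp lp dE]]; exists p; split=> //.
  by apply: sub_path pp => x y; apply: (subsetP HE).
(* Moving the factor 3 to the other side leaves a lower bound on an infimum, to be checked on single
   paths; the infinite distance needs no case of its own. *)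
rewrite -lee_pdivrMl //; apply: le_ereal_inf_tmp => d /= [p [pp lp ->]].
rewrite lee_pdivrMl //.
have [p' [pp' lp' sp']] := stretch_path inv pp.
apply: ereal_inf_lbound; exists p'; split=> //; first by rewrite lp'.
by rewrite sp' natrM EFinM.
Qed.

End Stretch.

(** * Initialization and edge updates *)

Section Algorithm.
Context (n w : nat) (hw : 8 * n.+1 ^ 3 <= 2 ^ w).
Implicit Types (s : state n) (E : edge_set n).

(** Minimality is phrased as the guard of [init_size], which thus succeeds exactly [q] times. *)
Definition is_ceil_sqrt q := n <= q * q /\ forall r, r < q -> r * r < n.

Lemma ceil_sqrt_exists : exists q, is_ceil_sqrt q.
Proof.
have [|q nq qmin] := ex_minnP (P := fun q => n <= q * q); first by exists n; nia.
exists q; split=> // r rq; rewrite ltnNge; apply/negP => /qmin; lia.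
Qed.

Lemma ceil_sqrt_le q : is_ceil_sqrt q -> q <= n.
Proof.
move=> [_ h]; rewrite leqNgt; apply/negP => /h; nia.
Qed.

Lemma run_init_size E q : is_ceil_sqrt q -> exists T,
  run w init_size (input_state E) T (fun s =>
    [/\ forall r, reg s r = if r == 4 then q else if r == 0 then n else 0,
        mem s = mem (input_state E) & out s = finset.set0]).
Proof.
move=> cq; have qn := ceil_sqrt_le cq; case: (cq) => nq qmin.
eexists; apply: (run_while (T := 4) (k := q) (I := fun j s =>
    [/\ forall r, reg s r = if r == 4 then j else if r == 0 then n else 0,
        mem s = mem (input_state E) & out s = finset.set0])).
- by split=> // r; rewrite /=; have [->|] := eqVneq r 4.
- move=> j s jq [rs ms os]; have := qmin j jq => jn.
  have E4 : eval w s (Reg 4) = j by rewrite /= rs.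
  have E0 : eval w s (Reg 0) = n by rewrite /= rs.
  split.
    rewrite (eval_bool hw _ _ _).1 eval_mul E4 ?E0 ?jn //.
    by apply: (small_word hw); nia.
  apply: run_impl (run_sem w s (_ : loop_free (Assign 4 _))) => // _ <-.
  split=> // r; rewrite /= /upd; case: eqP => [_|/eqP/negPf r4]; last by rewrite rs r4.
  have := @eval_add n w s (Reg 4) (Const 1).
  rewrite E4 eval_const //; last by lia.
  by rewrite addn1; apply; apply: (small_word hw); nia.
- move=> s [rs ms os].
  have E4 : eval w s (Reg 4) = q by rewrite /= rs.
  have E0 : eval w s (Reg 0) = n by rewrite /= rs.
  rewrite (eval_bool hw _ _ _).1 eval_mul E4 ?E0; first by rewrite ltnNge nq.
  by apply: (small_word hw); nia.
Qed.

Lemma input_mem E v x : v < n -> x < n ->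
  mem (input_state E) (v * n + x) = graph_arcs E v x.
Proof.
move=> vn xn; rewrite /=; have -> : v * n + x < n * n by nia.
by rewrite divnMDl ?modnMDl ?divn_small ?modn_small ?addn0 //; lia.
Qed.

(** All regions but 0 lie beyond the matrix and are initially 0, which encodes empty arrays and
    cleared flags. *)
Lemma spanner_inv_empty q D s E : reg s 0 = n -> reg s 4 = q ->
  mem s = mem (input_state E) -> out s = finset.set0 ->
  (forall v x, v < n -> x < n -> ~~ D v x) -> spanner_inv q D s.
Proof.
move=> s0 s4 ms os D0.
have z t a b c : a < n -> b < n -> c < n -> 0 < t -> mem_cell n (mem s) t a b c = 0.
  move=> an bn cn t0; rewrite ms /mem_cell /= ltnNge.
  suff -> : n * n <= addr n t a b c by [].
  rewrite /addr; nia.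
have ok f a b : a < n -> b < n -> array_at n (mem s) f a b.
  move=> an bn; have n0 : 0 < n by lia.
  split=> [x xn|j]; first by rewrite z //; lia.
  by rewrite z //; lia.
split=> //.
  split=> [v i vn i_n|v i x vn i_n xn]; first exact: ok.
  by rewrite z //; split=> // -[Dvx]; have := D0 v x vn xn; rewrite Dvx.
split.
- by move=> p x pn xn; exact: ok.
- move=> v x p vn xn pn; rewrite z //; split=> // -[Dvx].
  by have := D0 v x vn xn; rewrite Dvx.
- by move=> v x p p' vn xn pn p'n; rewrite z.
- by move=> v x p vn xn pn; rewrite z.
- by move=> v x vn xn; rewrite z //; lia.
- move=> e; rewrite os inE; split=> // -[v [x [vn xn]]].
  by rewrite z //; lia.
Qed.

Lemma bucket_degree_le_n q D v i : bucket_degree n q D v i <= n.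
Proof. by rewrite /bucket_degree -[X in _ <= X](size_iota 0 n) count_size. Qed.

Lemma run_init_arcs E q s : reg s 0 = n -> reg s 1 = 1 -> reg s 4 = q -> reg s 5 = 0 ->
  mem s = mem (input_state E) -> out s = finset.set0 -> exists T,
  run w init_arcs s T (spanner_inv q (graph_arcs E)).
Proof.
move=> s0 s1 s4 s5 ms os.
(* The arcs among the first [k] entries of the matrix. *)
pose D k : rel nat := fun v x => graph_arcs E v x && (v * n + x < k).
pose I k s' := [/\ spanner_inv q (D k) s', reg s' 1 = 1, reg s' 5 = k &
  forall a, a < n * n -> mem s' a = mem s a].
have nnE s' : reg s' 0 = n ->
    eval w s' (Bin OpMul (Reg 0) (Reg 0)) = n * n.
  by move=> s'0; rewrite eval_mul /= s'0 //; apply: (small_word hw); lia.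
eexists; apply: (@run_impl n w _ _ _ _ (I (n * n)) _ (leqnn _)).
  move=> s' [inv _ _ _]; apply: spanner_inv_ext inv => v x vn xn.
  by rewrite /D; have -> : v * n + x < n * n by [nia]; rewrite andbT.
(* A crude bound with bucket degrees at most [n]: the initialization only has to halt. *)
apply: (run_while (T := 4 + 2 + ccost (Seq (Assign 6 (Bin OpDiv (Reg 5) (Reg 0)))
   (Assign 7 (Bin OpMod (Reg 5) (Reg 0)))) + (1000 + 1000 * (n + n)) + 4)).
- split=> //; apply: (spanner_inv_empty s0 s4 ms os) => v x vn xn.
  by rewrite /D ltn0 andbF.
- move=> k s' kn [inv r1 r5 ms']; have s'0 : reg s' 0 = n by case: inv.
  split; first by rewrite (eval_bool hw _ _ _).1 nnE //= r5 kn.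
  have n0 : 0 < n by nia.
  have [vn xn] : k %/ n < n /\ k %% n < n by rewrite ltn_divLR // ltn_mod.
  have kE : k %/ n * n + k %% n = k by rewrite -divn_eq.
  have kw : k < 2 ^ w by apply: (small_word hw); lia.
  have memk : mem s' k = graph_arcs E (k %/ n) (k %% n).
    by rewrite ms' // ms -(input_mem E vn xn) kE.
  have Dk v x : v < n -> x < n ->
      D k.+1 v x = set_arc (D k) (k %/ n) (k %% n) (graph_arcs E (k %/ n) (k %% n)) v x.
    move=> vn' xn'; rewrite /D /set_arc ltnS leq_eqVlt.
    have [e|ne] := eqVneq (v * n + x) k.
      have [-> ->] := mulDn_inj xn' xn (etrans e (esym kE)).
      by rewrite !eqxx /= andbT.
    have [/andP[/eqP e1 /eqP e2]|_ //] := boolP ((v == k %/ n) && (x == k %% n)).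
    by move: ne; rewrite e1 e2 kE eqxx.
  apply: (@run_seq n w _ _ _ _ _ (fun s'' => [/\ spanner_inv q (D k.+1) s'',
      reg s'' 1 = 1, reg s'' 5 = k & forall a, a < n * n -> mem s'' a = mem s a])).
    apply: (@run_impl n w _ _ (ecost (Read (Reg 5)) +
      (ccost (Seq (Assign 6 (Bin OpDiv (Reg 5) (Reg 0)))
       (Assign 7 (Bin OpMod (Reg 5) (Reg 0)))) + (1000 + 1000 * (n + n)))).+1 _ _ _ _ (fun _ h => h)).
      by rewrite /=; lia.
    apply: run_if; rewrite /= r5 memk => kD.
      have {}kD : graph_arcs E (k %/ n) (k %% n) by move: kD; case: graph_arcs.
      pose s2 := set_reg (set_reg s' 6 (k %/ n)) 7 (k %% n).
      apply: run_seq (_ : forall s'', s'' = s2 -> _).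
        apply: run_impl (run_sem w s' (_ : loop_free (Seq (Assign 6 _) (Assign 7 _)))) => // _ <-.
        rewrite /= /binop_sem /= /upd /= r5 s'0.
        rewrite (@modn_small (k %/ n)) ?(@modn_small (k %% n)) //.
          by apply: leq_ltn_trans kw; exact: leq_mod.
        by apply: leq_ltn_trans kw; exact: leq_div.
      move=> _ ->.
      have inv2 : spanner_inv q (D k) s2.
        exact: spanner_inv_reg inv.
      have nD : D k (k %/ n) (k %% n) = ~~ (reg s2 1 != 0).
        by rewrite /= /upd /= r1 /D kE ltnn andbF.
      apply: run_impl (run_arc_update hw inv2 erefl erefl vn xn nD).
        by rewrite leq_add2l leq_mul2l leq_add ?bucket_degree_le_n.
      move=> s3 [inv3 r3 m3]; split.
      - apply: spanner_inv_ext inv3 => v x vn' xn'.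
        by rewrite Dk // kD /= /upd /= r1.
      - by rewrite r3 //= /upd /= r1.
      - by rewrite r3 //= /upd /= r5.
      - by move=> a an; rewrite m3 // -ms'.
    apply: run_impl (run_sem w s' (isT : loop_free Skip)) => [//|_ <-].
    split=> //; apply: spanner_inv_ext inv => v x vn' xn'; rewrite Dk //.
    rewrite /set_arc; case: andP => // -[/eqP -> /eqP ->].
    by rewrite /D kE ltnn andbF; case: graph_arcs kD.
  move=> s'' [inv'' r1'' r5'' m''].
  apply: run_impl (run_sem w s'' (_ : loop_free (Assign 5 _))) => // _ <-.
  rewrite (@sem_assign n w s'' 5 _ k.+1); last first.
    have := @eval_add n w s'' (Reg 5) (Const 1).
    rewrite /= r5'' modn_small; last by apply: (small_word hw); lia.
    by rewrite addn1; apply; apply: (small_word hw); lia.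
  by split=> //; exact: spanner_inv_reg inv''.
- move=> s' [inv r1 r5 _]; have s'0 : reg s' 0 = n by case: inv.
  by rewrite (eval_bool hw _ _ _).1 nnE //= r5 ltnn.
Qed.

Lemma run_init E : exists q T, is_ceil_sqrt q /\
  run w init (input_state E) T (spanner_inv q (graph_arcs E)).
Proof.
have [q cq] := ceil_sqrt_exists; exists q.
have [T1 [t1 [s1 [x1 _ [rs ms os]]]]] := run_init_size E cq.
have [|||||| T2 h2] := @run_init_arcs E q (set_reg s1 1 1); rewrite //= /upd /= ?rs //.
exists (t1 + (2 + T2)); split=> //.
apply: (run_seq (Q1 := eq s1)) => [|_ <-]; first by exists t1, s1.
apply: (run_seq (Q1 := eq (set_reg s1 1 1))) => [|_ <- //].
have := run_sem w s1 (isT : loop_free (Assign 1 (Const 1))).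
by rewrite [sem _ _ _]/= modn_small //; apply: (small_word hw); lia.
Qed.

Lemma degree_le_max E v : degree E v <= max_degree E.
Proof. exact: leq_bigmax. Qed.

(** Between the two arc updates the relation [D1] is not a graph, but its row at [u] is already that
    of [E'] and its row at [v] still that of [E]. So all four bucket degrees are bounded by degrees
    in [E] or [E']. *)
Lemma run_edge_update_arcs q E E' s (u v : 'I_n) (b : bool) d :
  0 < q -> spanner_inv q (graph_arcs E) s ->
  reg s 1 = b -> reg s 2 = u -> reg s 3 = v -> u != v -> graph_arcs E u v = ~~ b ->
  (forall x y, x < n -> y < n ->
     graph_arcs E' x y = set_arc (set_arc (graph_arcs E) u v b) v u b x y) ->
  max_degree E <= d -> max_degree E' <= d ->
  run w edge_update s (2008 + 4000 * minn d q) (spanner_inv q (graph_arcs E')).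
Proof.
move=> q0 inv r1 r2 r3 uv Duv DE' dE dE'.
have uvF : (u == v :> nat) = false by apply/negbTE.
have vuF : (v == u :> nat) = false by rewrite eq_sym.
set D1 := set_arc (graph_arcs E) u v b.
set D2 := set_arc D1 v u b in DE'.
have bE : (reg s 1 != 0) = b by rewrite r1; case: (b).
have bound (F : edge_set n) (x : 'I_n) i (D : rel nat) : (forall y, y < n -> D x y = graph_arcs F x y) ->
    max_degree F <= d -> bucket_degree n q D x i <= minn d q.
  move=> DF dF; rewrite leq_min bucket_degree_le_size // andbT (bucket_degree_ext _ _ DF).
  apply: leq_trans (bucket_degree_le_degree _ _ _ _) _.
  exact: leq_trans (degree_le_max _ _) dF.
have D12 y : D1 u y = D2 u y by rewrite /D2 /set_arc uvF.
have D01 y : D1 v y = graph_arcs E v y by rewrite /D1 /set_arc vuF.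
have b1 := bound E u (v %/ q) (graph_arcs E) (fun _ _ => erefl) dE.
have b2 : bucket_degree n q D1 u (v %/ q) <= minn d q.
  by apply: bound dE' => y yn; rewrite D12 DE'.
have b3 : bucket_degree n q D1 v (u %/ q) <= minn d q.
  by apply: bound dE => y yn; rewrite D01.
have b4 : bucket_degree n q D2 v (u %/ q) <= minn d q.
  by apply: bound dE' => y yn; rewrite DE'.
apply: (@run_impl n w _ _ (4 + ((1000 + 1000 * (minn d q + minn d q)) +
   (4 + (1000 + 1000 * (minn d q + minn d q))))) _ _ _ _ (fun _ h => h)); first by lia.
pose s1 := set_reg (set_reg s 6 u) 7 v.
apply: (run_seq (Q1 := eq s1)) => [|_ <-].
  apply: run_impl (run_sem w s (_ : loop_free (Seq (Assign 6 _) (Assign 7 _)))) => // _ <-.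
  by rewrite /s1 /= /upd /= r2 r3.
have inv1 : spanner_inv q (graph_arcs E) s1 by exact: spanner_inv_reg inv.
have Duv1 : graph_arcs E u v = ~~ (reg s1 1 != 0) by rewrite [reg s1 1]/= bE.
apply: (run_seq (Q1 := fun s2 => spanner_inv q D1 s2 /\
    forall r, r < 8 -> reg s2 r = reg s1 r)).
  apply: run_impl (run_arc_update hw inv1 erefl erefl (ltn_ord u) (ltn_ord v) Duv1).
    by rewrite [reg s1 1]/= bE leq_add2l leq_mul2l leq_add.
  by rewrite [reg s1 1]/= bE => s2 [].
move=> s2 [inv2 k2].
pose s3 := set_reg (set_reg s2 6 v) 7 u.
apply: (run_seq (Q1 := eq s3)) => [|_ <-].
  apply: run_impl (run_sem w s2 (_ : loop_free (Seq (Assign 6 _) (Assign 7 _)))) => // _ <-.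
  by rewrite /s3 /= /upd /= !k2 //= /upd /= r2 r3.
have inv3 : spanner_inv q D1 s3 by exact: spanner_inv_reg inv2.
have bE3 : (reg s3 1 != 0) = b by rewrite [reg s3 1]k2.
have Dvu3 : D1 v u = ~~ (reg s3 1 != 0) by rewrite bE3 D01 graph_arcsC.
apply: run_impl (run_arc_update hw inv3 erefl erefl (ltn_ord v) (ltn_ord u) Dvu3).
  by rewrite bE3 leq_add2l leq_mul2l leq_add.
rewrite bE3 => s4 [inv4 _ _]; apply: spanner_inv_ext inv4 => x y xn yn.
by rewrite DE'.
Qed.

Lemma run_edge_update q E s up : 0 < q -> simple_graph E -> valid_update E up ->
  spanner_inv q (graph_arcs E) s ->
  run w edge_update (receive up s) (2008 + 4000 * minn (update_max_degree E up) q)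
    (spanner_inv q (graph_arcs (apply_update E up))).
Proof.
move=> q0 sE val inv.
have edgeE (u v : 'I_n) x y : x < n -> y < n ->
    (word_edge n x y == u |: [set v]) =
    (x == v) && (y == u) || (x == u) && (y == v).
  move=> xn yn; rewrite -word_edge_ord; apply/eqP/idP.
    by case/(word_edge_inj xn yn (ltn_ord u) (ltn_ord v)) => -[-> ->]; rewrite !eqxx ?orbT.
  by case/orP => /andP[/eqP -> /eqP ->] //; rewrite word_edgeC.
have dE : max_degree E <= update_max_degree E up by exact: leq_maxl.
have dE' : max_degree (apply_update E up) <= update_max_degree E up by exact: leq_maxr.
have invr : spanner_inv q (graph_arcs E) (receive up s).
  by case: up {val dE dE'} => u v; exact: spanner_inv_reg inv.
case: up val dE dE' invr => u v val dE dE' invr.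
- case/andP: (val) => uv nuv.
  apply: (run_edge_update_arcs (b := true) q0 invr) uv _ _ dE dE' => //.
    by rewrite graph_arcs_ord; exact: negbTE.
  move=> x y xn yn; rewrite /graph_arcs /set_arc /= !inE edgeE //.
  by case: ((x == v) && (y == u)); case: ((x == u) && (y == v)); rewrite ?orbT ?orbF.
- have uv := simple_adj_neq sE val.
  apply: (run_edge_update_arcs (b := false) q0 invr) uv _ _ dE dE' => //.
    by rewrite graph_arcs_ord.
  move=> x y xn yn; rewrite /graph_arcs /set_arc /= !inE edgeE //.
  by case: ((x == v) && (y == u)); case: ((x == u) && (y == v)).
Qed.

End Algorithm.

(** * The algorithm and its reachable states *)

Definition spanner_algorithm := DynAlgorithm init edge_update.

(** The right side is [B ^ 6] for a power [B] of 2 that is at least 2 and exceeds [n]: three factors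
    cover 8 and three cover [n.+1 ^ 3]. *)
Lemma word_bits_large n : 8 * n.+1 ^ 3 <= 2 ^ word_bits 5 n.
Proof.
rewrite /word_bits (mulnC 6) expnM; set B := 2 ^ _.
have nB : n < B by apply: trunc_log_ltn.
have B2 : 2 <= B by rewrite /B expnS; have := expn_gt0 2 (trunc_log 2 n); lia.
rewrite (expnD B 3 3) leq_mul //; first by rewrite (leq_exp2r 2 B (isT : 0 < 3)).
by rewrite leq_exp2r.
Qed.

Lemma reachable_inv n (E0 E : edge_set n) s : simple_graph E0 ->
  reachable spanner_algorithm (word_bits 5 n) E0 E s ->
  simple_graph E /\ exists2 q, is_ceil_sqrt n q & spanner_inv q (graph_arcs E) s.
Proof.
move=> sE0; have hw := word_bits_large n.
elim=> {E s} [t s x|E s up t s' _ [sE [q cq inv]] val x].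
  have [q [T [cq [t' [s' [x' _ inv]]]]]] := run_init hw E0.
  (* The given execution is the one for which the invariant has been shown. *)
  have [_ ->] := exec_deterministic x x'; split=> //.
  by exists q.
split; first exact: simple_apply_update.
exists q => //.
have n0 : 0 < n by case: up {val x} => u v; apply: leq_ltn_trans (ltn_ord u).
have q0 : 0 < q by case: cq => nq _; rewrite lt0n; apply/eqP => e; move: nq; rewrite e; lia.
have [t' [s'' [x' _ inv']]] := run_edge_update hw q0 sE val inv.
by have [_ ->] := exec_deterministic x x'.
Qed.

(** The updated edge is present before or after the update. Positivity is what absorbs the additive
    constant of the running time. *)
Lemma update_max_degree_gt0 n (E : edge_set n) up : valid_update E up ->
  0 < update_max_degree E up.
Proof.
have deg F (u v : 'I_n) : adj F u v -> 0 < max_degree F.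
  move=> uv; apply: leq_trans (degree_le_max F u); apply/card_gt0P.
  by exists v.
case: up => u v val; rewrite leq_max.
  by apply/orP; right; apply: (deg _ u v); rewrite /adj /= !inE eqxx orbT.
by apply/orP; left; exact: deg val.
Qed.

(** * Real estimates and the theorem *)

Section RealBounds.
Context (R : realType).
Local Open Scope ring_scope.

Lemma ceil_sqrt_le_sqrt n q : (0 < n)%N -> is_ceil_sqrt n q ->
  q%:R <= 2 * Num.sqrt n%:R :> R.
Proof.
move=> n0 [nq qmin].
(* For [q] at least 2, [q] is at most twice [q.-1], whose square is below [n]. *)
have q4 : (q * q <= 2 * 2 * n)%N.
  have [q2|q2] := leqP 2 q; last by nia.
  by have := qmin q.-1 ltac:(lia); nia.
rewrite -(@ler_pXn2r _ 2) ?nnegrE ?mulr_ge0 ?sqrtr_ge0 //.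
by rewrite exprMn sqr_sqrtr // -!natrX -natrM ler_nat -mulnn.
Qed.

Lemma powR_three_halves n : (n%:R : R) `^ (3 / 2) = n%:R * Num.sqrt n%:R.
Proof.
have -> : 3 / 2 = 1 + 2^-1 :> R by lra.
by rewrite powRD ?powRr1 ?powR12_sqrt //; apply/implyP => /eqP; lra.
Qed.

(** From the inequality between [ln (1 + x)] and [x] at [x = - 2^-1]. *)
Lemma ln_ge_half n : (2 <= n)%N -> 2^-1 <= ln n%:R :> R.
Proof.
move=> n2; apply: (@le_trans _ _ (ln 2)); last first.
  by rewrite ler_ln ?posrE ?ltr0n ?ler_nat //; lia.
have := @le_ln1Dx R (- 2^-1) ltac:(lra).
have -> : 1 + - 2^-1 = 2^-1 :> R by lra.
by rewrite lnV ?posrE // lerN2.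
Qed.

End RealBounds.

Local Open Scope ring_scope.

Theorem theorem3 (R : realType) :
  exists (A : dyn_algorithm) (k : nat) (Csize Ctime : R),
  forall (n : nat) (E0 : edge_set n), simple_graph E0 ->
    (exists (t : nat) (s : state n),
       exec (word_bits k n) (init_prog A) (input_state E0) t s) /\
    (forall (E : edge_set n) (s : state n),
       reachable A (word_bits k n) E0 E s ->
       [/\ spanner (3 : R) E (out s),
           #|out s|%:R <= Csize * (n%:R : R) `^ (3 / 2) &
           forall up : update n, valid_update E up ->
             exists (t : nat) (s' : state n),
               exec (word_bits k n) (update_prog A) (receive up s) t s' /\
               t%:R <= Ctime *
                 (Num.min (update_max_degree E up)%:R (Num.sqrt n%:R) * ln n%:R)]).
Proof.
(* The size is at most [2 * n * q] and [q] at most twice the square root of [n], hence 4. For the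
   time, 6400 exceeds 2008 + 4000; one factor 2 again comes from [q], the other from the lower bound
   [2^-1] on [ln n%:R]. *)
exists spanner_algorithm, 5%N, 4, (80 * 80 * 4) => n E0 sE0.
have hw := word_bits_large n; split.
  by have [q [T [_ [t [s [x _ _]]]]]] := run_init hw E0; exists t, s.
move=> E s /(reachable_inv sE0)[sE [q cq inv]]; split.
- exact: spanner_of_inv inv.
- have := card_out_le cq.1 inv; rewrite -(ler_nat R) => /le_trans; apply.
  rewrite powR_three_halves !natrM.
  have [->|n0] := posnP n; first by rewrite !mul0r !mulr0.
  have := ceil_sqrt_le_sqrt R n0 cq.
  by have : 0 <= n%:R :> R by []; nra.
- move=> up val.
  (* A valid update involves two distinct vertices, which excludes the values of [n] whose logarithm
     vanishes. *)
  have n2 : (2 <= n)%N.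
    have [u [v uv]] : exists u v : 'I_n, u != v.
      case: up val => u v /=; first by case/andP; exists u, v.
      by move=> uv; exists u, v; exact: simple_adj_neq uv.
    rewrite leqNgt; apply/negP => n1; move: uv; apply/negP; rewrite negbK.
    by apply/eqP/val_inj => /=; have := ltn_ord u; have := ltn_ord v; lia.
  have q0 : (0 < q)%N.
    by case: cq => nq _; rewrite lt0n; apply/eqP => e; move: nq; rewrite e; lia.
  have [t [s' [x tle _]]] := run_edge_update hw q0 sE val inv.
  exists t, s'; split=> //.
  have d0 := update_max_degree_gt0 val.
  set d := update_max_degree E up in d0 tle *.
  set m := Num.min _ _.
  have qs := ceil_sqrt_le_sqrt R (ltnW n2) cq.
  have mle : (minn d q)%:R <= 2 * m.
    rewrite /m /Num.min; case: ifP => _.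
      have : (minn d q)%:R <= d%:R :> R by rewrite ler_nat geq_minl.
      by have : 0 <= d%:R :> R by []; lra.
    by apply: le_trans qs; rewrite ler_nat geq_minr.
  have tm : t%:R <= 80 * 80 * (minn d q)%:R :> R.
    rewrite -!natrM ler_nat; apply: leq_trans tle _.
    have : (0 < minn d q)%N by rewrite leq_min d0.
    by lia.
  have := ln_ge_half R n2.
  have : 0 <= m by rewrite le_min ler0n sqrtr_ge0.
  nra.
Qed.
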